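(* Let $X$ be a compact Hausdorff space, let $\gamma=\{\gamma_1,\ldots,\gamma_N\}$ be an iterated function system on $X$, and let $\mathbb{X}\subseteq X$ be a subset. Assume: (i) $\mathbb{X}$ is dense in $X$ and completely invariant under $\gamma$; (ii) the images $\gamma_1(\mathbb{X}),\ldots,\gamma_N(\mathbb{X})$ are pairwise disjoint; (iii) the restriction $\gamma_k|_{\mathbb{X}}$ is injective for all $k=1,\ldots,N$; (iv) the maps $\gamma_1,\ldots,\gamma_N$ are (topological) embeddings; (v) there is a dense open set $U$ in $X$ such that the images $\gamma_1(U),\ldots,\gamma_N(U)$ are pairwise disjoint open sets in $X$ contained in $U$, and $\mathbb{X}\subseteq U$; (vi) $\mathbb{X}$ is comeager in $X$. Assume further: (a) $\gamma$ is essentially free; (b) the set $\gamma^n(X)$ is clopen in $X$ for all $n\in\mathbb{N}$; (c) there exists a continuous map $\sigma:\gamma(X)\to X$ such that $\sigma\circ\gamma_k=\mathrm{id}_X$ for all $k\in\{1,\ldots,N\}$. Let $\hat\rho=(\hat\rho_A,\hat\rho_E)$, $C^*(\hat\rho)$ and $\hat D\subseteq C^*(\hat\rho)$ be as constructed in the context. Then $\hat\rho_A(A)=\hat D$, and hence $\hat\rho_A(A)$ is a masa of $C^*(\hat\rho)$.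
   Context: An iterated function system on $X$ is a finite family $\gamma=\{\gamma_1,\ldots,\gamma_N\}$ (repetitions allowed) of continuous maps $X\to X$. Put $I=\{1,\ldots,N\}$. For $\boldsymbol k=(k_n,\ldots,k_1)\in I^n$ put $\gamma_{\boldsymbol k}=\gamma_{k_n}\circ\cdots\circ\gamma_{k_1}$ (the identity if $n=0$). For $S\subseteq X$ put $\gamma(S)=\bigcup_{k}\gamma_k(S)$, $\gamma^0(S)=S$, $\gamma^{n+1}(S)=\gamma(\gamma^n(S))$. $S$ is completely invariant under $\gamma$ if $\gamma_k(S)\subseteq S$ and $\gamma_k^{-1}(S)\subseteq S$ for all $k$. $\gamma$ is essentially free if $\{x\in X:\gamma_{\boldsymbol k}(x)=\gamma_{\boldsymbol l}(x)\}$ is nowhere dense for all finite index sequences $\boldsymbol k\neq\boldsymbol l$ (of possibly different lengths, possibly empty). Let $M_{\mathbb{X}}$ be the C*-algebra of bounded operators on $\ell^2(\mathbb{X})$ (orthonormal basis $(e_x)_{x\in\mathbb{X}}$, inner products linear in the second variable) and $D_{\mathbb{X}}\subseteq M_{\mathbb{X}}$ the set of diagonal operators, i.e. those $\alpha$ with $\langle e_x|\alpha e_y\rangle=0$ for $x\ne y$. Let $G=\bigcup_{k}\{(\gamma_k(y),y):y\in X\}\subseteq X\times X$ be the graph of $\gamma$, $A=C(X)$, $E=C(G)$. Define $\rho_A:A\to M_{\mathbb{X}}$ and $\rho_E:E\to M_{\mathbb{X}}$ by $\rho_A(a)e_x=a(x)e_x$ and $\rho_E(f)e_y=\sum_{k=1}^N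 f(\gamma_k(y),y)\,e_{\gamma_k(y)}$. Let $\upsilon_n$ $(n\in\mathbb{Z})$ be the unitary $e_k\mapsto e_{n+k}$ on $\ell^2(\mathbb{Z})$ and $C^*(\mathbb{Z})$ the C*-algebra generated by the $\upsilon_n$. Define $\hat\rho_A(a)=\rho_A(a)\otimes\upsilon_0$, $\hat\rho_E(f)=\rho_E(f)\otimes\upsilon_1$ in $M_{\mathbb{X}}\otimes C^*(\mathbb{Z})$, and let $C^*(\hat\rho)$ be the C*-subalgebra generated by $\hat\rho_A(A)\cup\hat\rho_E(E)$. For $n\in\mathbb{N}_0$ a $\gamma$-chain of length $n$ is a tuple $(x_n,\ldots,x_0)\in X^{n+1}$ such that for each $i$ there is $k\in I$ with $x_i=\gamma_k(x_{i-1})$; for $\boldsymbol k=(k_n,\ldots,k_1)\in I^n$ and $x\in X$ let $\boldsymbol\gamma_{\boldsymbol k}(x)=(\gamma_{k_n,\ldots,k_1}(x),\ldots,\gamma_{k_1}(x),x)$. Let $X_{m,n}$ be the compact space of pairs $(\boldsymbol x,\boldsymbol y)$ of $\gamma$-chains of lengths $m$ and $n$ with the same last entry $x_0=y_0$. Define a linear map $\rho_{m,n}:C(X_{m,n})\to M_{\mathbb{X}}$ as follows: for $y\in\gamma^n(\mathbb{X})$ there are unique $\boldsymbol k\in I^n$, $x\in\mathbb{X}$ with $y=\gamma_{\boldsymbol k}(x)$, and $\rho_{m,n}(f)e_y=\sum_{\boldsymbol j\in I^m}f(\boldsymbol\gamma_{\boldsymbol j}(x),\boldsymbol\gamma_{\boldsymbol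 k}(x))\,e_{\gamma_{\boldsymbol j}(x)}$; for $y\in\mathbb{X}\setminus\gamma^n(\mathbb{X})$, $\rho_{m,n}(f)e_y=0$. Let $E_{m,n}$ be the range of $\rho_{m,n}$. For $k\in\mathbb{Z}$ let $B_k$ be the norm-closed linear span of $\bigcup_{m-n=k}E_{m,n}$ ($m,n\in\mathbb{N}_0$), and $D_k=B_k\cap D_{\mathbb{X}}$. Let $\hat D=\bigoplus_{k\in\mathbb{Z}}D_k\otimes\upsilon_k$, meaning the norm-closed linear span of the subspaces $D_k\otimes\upsilon_k=\{\alpha\otimes\upsilon_k:\alpha\in D_k\}$; it is a closed commutative $*$-subalgebra of $C^*(\hat\rho)$ containing $\hat\rho_A(A)$. A masa is a maximal commutative $*$-subalgebra. *)

(* Defs.v *)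
From HB Require Import structures.
From mathcomp Require Import all_boot all_order all_algebra.
From mathcomp Require Import all_classical all_reals all_analysis.
From mathcomp Require Import complex ring.

Set Implicit Arguments.
Unset Strict Implicit.
Unset Printing Implicit Defensive.

Import Order.TTheory GRing.Theory Num.Theory.
Import numFieldNormedType.Exports.

Local Open Scope classical_set_scope.
Local Open Scope ring_scope.

Section square_summable.
Variables (R : realType) (S : choiceType).
Implicit Types f g : S -> R[i].

Definition sqnorm f : \bar R :=
  (\esum_(s in [set: S]) (Normc.normc (f s) ^+ 2)%:E)%E.

Definition square_summable : {pred S -> R[i]} :=
  fun f => (sqnorm f < +oo)%E.

Lemma sqnorm_ge0 f : (0 <= sqnorm f)%E.
Proof. by apply: esum_ge0 => s _; rewrite lee_fin sqr_ge0. Qed.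

Lemma sqnorm_leP f (M : R) :
  (sqnorm f <= M%:E)%E <->
  (forall s : seq S, uniq s -> \sum_(x <- s) Normc.normc (f x) ^+ 2 <= M).
Proof.
split=> [fM s us|fM].
  rewrite -lee_fin -sumEFin; apply: le_trans fM.
  apply: esum_ge; exists [set` s]; first by split.
  by rewrite fsbig_seq.
apply: ge_ereal_sup => _ [A [finA _] <-].
by rewrite fsbig_finite//= sumEFin lee_fin fM.
Qed.

Lemma square_summableP f : reflect
  (exists M : R, forall s : seq S, uniq s ->
    \sum_(x <- s) Normc.normc (f x) ^+ 2 <= M) (f \in square_summable).
Proof.
rewrite unfold_in; apply: (iffP idP) => [foo|[M /sqnorm_leP fM]].
  exists (fine (sqnorm f)); apply/sqnorm_leP.
  by rewrite fineK// ge0_fin_numE// sqnorm_ge0.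
by apply: le_lt_trans fM _; rewrite ltry.
Qed.

Lemma normc_ge0 (z : R[i]) : 0 <= Normc.normc z.
Proof. by case: z => x y; exact: sqrtr_ge0. Qed.

Lemma sqr_normcD (t : R) (a b : R[i]) : 0 < t ->
  Normc.normc (a + b) ^+ 2 <=
    (1 + t) * Normc.normc a ^+ 2 + (1 + t^-1) * Normc.normc b ^+ 2.
Proof.
move=> t0; apply: (@le_trans _ _ ((Normc.normc a + Normc.normc b) ^+ 2)).
  by rewrite ler_sqr ?nnegrE ?addr_ge0 ?normc_ge0// le_normcD.
move: (Normc.normc a) (Normc.normc b) => p q; rewrite -subr_ge0.
suff -> : (1 + t) * p ^+ 2 + (1 + t^-1) * q ^+ 2 - (p + q) ^+ 2 =
          (t * p - q) ^+ 2 / t.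
  by rewrite divr_ge0 ?sqr_ge0// ltW.
by field; exact: lt0r_neq0.
Qed.

Lemma sum_sqr_normcD (t A B : R) f g : 0 < t ->
  (forall s : seq S, uniq s -> \sum_(x <- s) Normc.normc (f x) ^+ 2 <= A) ->
  (forall s : seq S, uniq s -> \sum_(x <- s) Normc.normc (g x) ^+ 2 <= B) ->
  forall s : seq S, uniq s ->
  \sum_(x <- s) Normc.normc ((f + g) x) ^+ 2 <= (1 + t) * A + (1 + t^-1) * B.
Proof.
move=> t0 fA gB s us.
have -> : (f + g) = (fun x => f x + g x) by apply/funext.
apply: (@le_trans _ _ (\sum_(x <- s) ((1 + t) * Normc.normc (f x) ^+ 2 +
    (1 + t^-1) * Normc.normc (g x) ^+ 2))).
  by apply: ler_sum => x _; exact: sqr_normcD.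
rewrite big_split/= -!mulr_sumr lerD//.
  by rewrite ler_wpM2l ?fA// addr_ge0// ltW.
by rewrite ler_wpM2l ?gB// addr_ge0// ltW// invr_gt0.
Qed.

Lemma sum_sqr_normcZ (c : R[i]) (A : R) f :
  (forall s : seq S, uniq s -> \sum_(x <- s) Normc.normc (f x) ^+ 2 <= A) ->
  forall s : seq S, uniq s ->
  \sum_(x <- s) Normc.normc ((c *: f) x) ^+ 2 <= Normc.normc c ^+ 2 * A.
Proof.
move=> fA s us.
have -> : c *: f = (fun x => c * f x) by apply/funext.
under eq_bigr do rewrite Normc.normcM exprMn.
by rewrite -mulr_sumr ler_wpM2l ?fA// sqr_ge0.
Qed.

Lemma square_summable_submod : submod_closed square_summable.
Proof.
split.
  apply/square_summableP; exists 0 => s _; rewrite big1// => x _.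
  by rewrite Normc.normc0 expr0n.
move=> c f g /square_summableP[A fA] /square_summableP[B gB].
apply/square_summableP; eexists.
exact: (sum_sqr_normcD ltr01 (sum_sqr_normcZ c fA) gB).
Qed.

HB.instance Definition _ :=
  GRing.isSubmodClosed.Build R[i] (S -> R[i]) square_summable
    square_summable_submod.

Record l2 := L2 { l2_fun :> S -> R[i]; _ : l2_fun \in square_summable }.

HB.instance Definition _ := [isSub for l2_fun].
HB.instance Definition _ := [Choice of l2 by <:].
HB.instance Definition _ := [SubChoice_isSubLmodule of l2 by <:].

End square_summable.

Section l2_normed.
Variables (R : realType) (S : choiceType).
Local Notation l2 := (l2 R S).
Implicit Types f g : l2.

Definition l2norm (f : l2) : R := Num.sqrt (fine (sqnorm f)).

Lemma l2_ext (f g : l2) : (forall x, f x = g x) -> f = g.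
Proof. by move=> fg; apply/val_inj/funext. Qed.

Lemma l2normP (f : l2) (M : R) : 0 <= M ->
  l2norm f <= M <->
  (forall s : seq S, uniq s -> \sum_(x <- s) Normc.normc (f x) ^+ 2 <= M ^+ 2).
Proof.
move=> M0; rewrite -sqnorm_leP.
have ff : sqnorm f \is a fin_num.
  by rewrite ge0_fin_numE ?sqnorm_ge0//; case: f.
rewrite -[in X in _ <-> X](fineK ff) lee_fin /l2norm.
have {1}-> : M = Num.sqrt (M ^+ 2) by rewrite sqrtr_sqr ger0_norm.
by rewrite ler_sqrt// exprn_ge0.
Qed.

Lemma l2norm_ge0 f : 0 <= l2norm f.
Proof. exact: sqrtr_ge0. Qed.

Lemma le_l2norm f (s : seq S) : uniq s ->
  \sum_(x <- s) Normc.normc (f x) ^+ 2 <= l2norm f ^+ 2.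
Proof. by move: s; apply/l2normP => //; exact: l2norm_ge0. Qed.

Lemma l2norm0_eq0 f : l2norm f = 0 -> f = 0.
Proof.
move=> f0; apply: l2_ext => x; have := @le_l2norm f [:: x] isT.
rewrite f0 big_seq1 expr0n/= => nfx.
apply: Normc.eq0_normc; apply/eqP; rewrite -sqrf_eq0; apply/eqP/le_anti.
by rewrite nfx sqr_ge0.
Qed.

Lemma l2normD f g : l2norm (f + g) <= l2norm f + l2norm g.
Proof.
have [/l2norm0_eq0 ->|f0] := eqVneq (l2norm f) 0.
  by rewrite add0r lerDr l2norm_ge0.
have [/l2norm0_eq0 ->|g0] := eqVneq (l2norm g) 0.
  by rewrite addr0 lerDl l2norm_ge0.
have pf : 0 < l2norm f by rewrite lt_def f0 l2norm_ge0.
have pg : 0 < l2norm g by rewrite lt_def g0 l2norm_ge0.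
apply/l2normP; first by rewrite addr_ge0// ltW.
move=> s us; have t0 : 0 < l2norm g / l2norm f by rewrite divr_gt0.
have := sum_sqr_normcD t0 (@le_l2norm f) (@le_l2norm g) us.
move/le_trans; apply; rewrite le_eqVlt; apply/orP; left; apply/eqP.
by field; rewrite f0.
Qed.

Lemma le_l2normZ (c : R[i]) f : l2norm (c *: f) <= Normc.normc c * l2norm f.
Proof.
apply/l2normP; first by rewrite mulr_ge0 ?normc_ge0 ?l2norm_ge0.
by move=> s us; rewrite exprMn; apply: sum_sqr_normcZ us; exact: le_l2norm.
Qed.

Lemma l2normZ (c : R[i]) f : l2norm (c *: f) = Normc.normc c * l2norm f.
Proof.
have [->|c0] := eqVneq c 0.
  apply/le_anti/andP; split; first exact: le_l2normZ.
  by rewrite Normc.normc0 mul0r l2norm_ge0.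
have nc0 : 0 < Normc.normc c.
  rewrite lt_def normc_ge0 andbT; apply: contra c0 => /eqP.
  by move=> /Normc.eq0_normc ->.
apply/le_anti; rewrite le_l2normZ/= -ler_pdivlMl//.
by rewrite -Normc.normcV -{1}[f](scalerK c0) le_l2normZ.
Qed.

Let l2normC (f : l2) : R[i] := ((l2norm f)%:C)%C.

Let l2normCD f g : l2normC (f + g) <= l2normC f + l2normC g.
Proof. by rewrite /l2normC -rmorphD/= lecR l2normD. Qed.

Let l2normCZ (c : R[i]) f : l2normC (c *: f) = `|c| * l2normC f.
Proof. by rewrite /l2normC l2normZ rmorphM. Qed.

Let l2normC0_eq0 f : l2normC f = 0 -> f = 0.
Proof. by move=> /complexI/l2norm0_eq0. Qed.

HB.instance Definition _ :=
  Lmodule_isNormed.Build R[i] l2 l2normCD l2normCZ l2normC0_eq0.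

Lemma l2_normE f : `|f| = ((l2norm f)%:C)%C.
Proof. by []. Qed.

End l2_normed.

Section l2_vectors.
Variable R : realType.

Lemma l2_basis_subproof (S : choiceType) (s : S) :
  (fun x => (x == s)%:R) \in @square_summable R S.
Proof.
apply/square_summableP; exists 1 => t ut.
have [st|st] := boolP (s \in t).
  rewrite (bigD1_seq s)//= eqxx Normc.normc1 expr1n big1 ?addr0// => x.
  by move=> /negPf ->; rewrite Normc.normc0 expr0n.
rewrite big1_seq// => x /andP[_ xt].
have /negPf -> : x != s by apply: contraNneq st => <-.
by rewrite Normc.normc0 expr0n.
Qed.

Definition l2_basis (S : choiceType) (s : S) : l2 R S :=
  L2 (l2_basis_subproof s).

Lemma tensv_subproof (S T : choiceType) (u : l2 R S) (v : l2 R T) :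
  (fun p : S * T => u p.1 * v p.2) \in @square_summable R (S * T)%type.
Proof.
apply/square_summableP; exists (l2norm u ^+ 2 * l2norm v ^+ 2) => t ut.
set t1 := undup (map fst t); set t2 := undup (map snd t).
apply: (@le_trans _ _ (\sum_(p <- [seq (a, b) | a <- t1, b <- t2])
    Normc.normc (u p.1 * v p.2) ^+ 2)).
  rewrite [leRHS](bigID (mem t))/= -[leLHS]addr0 lerD//; last first.
    by apply: sumr_ge0 => p _; exact: sqr_ge0.
  rewrite le_eqVlt; apply/orP; left; apply/eqP; rewrite -[RHS]big_filter.
  apply: perm_big; apply: uniq_perm => //.
    rewrite filter_uniq// allpairs_uniq ?undup_uniq//.
    by move=> [a b] [c d] _ _ [-> ->].
  move=> [a b]; rewrite mem_filter/=; case abt: ((a, b) \in t) => //=.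
  apply/esym/allpairsP; exists (a, b).
  by rewrite !mem_undup; split=> //=; apply/mapP; exists (a, b).
rewrite big_allpairs/=.
under eq_bigr do under eq_bigr do rewrite Normc.normcM exprMn.
under eq_bigr do rewrite -mulr_sumr.
rewrite -mulr_suml ler_pM ?le_l2norm ?undup_uniq//.
  by apply: sumr_ge0 => x _; exact: sqr_ge0.
by apply: sumr_ge0 => x _; exact: sqr_ge0.
Qed.

(* l2 R S (x) l2 R T is realized as l2 R (S * T), with elementary tensors
   (u (x) v) (s, t) = u s * v t *)
Definition tensv (S T : choiceType) (u : l2 R S) (v : l2 R T)
  : l2 R (S * T)%type := L2 (tensv_subproof u v).

Lemma l2_shift_subproof (n : int) (v : l2 R int) :
  (fun k => v (k - n)) \in @square_summable R int.
Proof.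
apply/square_summableP; exists (l2norm v ^+ 2) => s us.
have := @le_l2norm _ _ v (map (fun k => k - n) s).
by rewrite big_map map_inj_uniq; [exact|exact: addIr].
Qed.

(* e_k |-> e_(n + k) *)
Definition l2_shift (n : int) (v : l2 R int) : l2 R int :=
  L2 (l2_shift_subproof n v).

End l2_vectors.

Section operators.
Variables (R : realType) (S : choiceType).
Local Notation H := (l2 R S).
Implicit Types (T : H -> H) (B G : set (H -> H)).

(* the sum of the family f when f is absolutely summable; meaningless
   otherwise *)
Definition abs_sum (f : S -> R) : R :=
  fine (\esum_(s in [set: S]) (f^\+ s)%:E)
  - fine (\esum_(s in [set: S]) (f^\- s)%:E).

(* linear in the second variable *)
Definition inner (u v : H) : R[i] :=
  (abs_sum (fun s => complex.Re ((u s)^* * v s))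
   +i* abs_sum (fun s => complex.Im ((u s)^* * v s)))%C.

Definition bounded_op T := linear T /\ continuous T.

Definition is_adjoint T T' := forall u v, inner (T u) v = inner u (T' v).

Definition diagonal_op : set (H -> H) :=
  [set T | bounded_op T /\
    forall x y, x <> y -> inner (l2_basis R x) (T (l2_basis R y)) = 0].

Definition op_subspace B :=
  B 0 /\ forall (c : R[i]) T T', B T -> B T' -> B (c *: T + T').

(* closure in the operator norm, within the bounded operators *)
Definition op_closure B : set (H -> H) :=
  [set T | bounded_op T /\ forall e : R[i], 0 < e ->
    exists2 T', B T' & forall u, `|T u - T' u| <= e * `|u|].

Definition closed_span G : set (H -> H) :=
  op_closure (smallest op_subspace G).

Definition star_subalgebra B :=
  [/\ B `<=` bounded_op, op_subspace B,
      forall T T', B T -> B T' -> B (T \o T')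
    & forall T T', B T -> bounded_op T' -> is_adjoint T T' -> B T'].

Definition cstar_subalgebra B := star_subalgebra B /\ op_closure B `<=` B.

Definition cstar_generated G : set (H -> H) := smallest cstar_subalgebra G.

Definition commutative_star_subalgebra B :=
  star_subalgebra B /\ forall T T', B T -> B T' -> T \o T' = T' \o T.

Definition masa (D A : set (H -> H)) :=
  [/\ commutative_star_subalgebra D, D `<=` A
    & forall D', commutative_star_subalgebra D' -> D `<=` D' -> D' `<=` A ->
      D' = D].

End operators.

(* T is the operator a (x) b; it is determined by its values on elementary
   tensors. *)
Definition is_tensor (R : realType) (S S' : choiceType)
    (a : l2 R S -> l2 R S) (b : l2 R S' -> l2 R S')
    (T : l2 R (S * S')%type -> l2 R (S * S')%type) :=
  bounded_op T /\ forall u v, T (tensv u v) = tensv (a u) (b v).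

Section topology.
Variables X Y : topologicalType.

Definition topological_embedding (f : X -> Y) :=
  [/\ continuous f, injective f
    & forall A, open A -> exists2 B, open B & f @` A = range f `&` B].

Definition nowhere_dense (A : set X) := (closure A)° = set0.

Definition meager (A : set X) :=
  exists2 F : nat -> set X, (forall n, nowhere_dense (F n))
    & A = \bigcup_n F n.

Definition comeager (A : set X) := meager (~` A).

End topology.

Section ifs.
Variables (X : topologicalType) (N : nat) (gamma : 'I_N -> X -> X).

Definition ifs_image (A : set X) : set X := \bigcup_k (gamma k @` A).

(* comp_word [:: k_n; ...; k_1] = gamma_(k_n) \o ... \o gamma_(k_1) *)
Definition comp_word (k : seq 'I_N) : X -> X := fun x => foldr gamma x k.

Definition completely_invariant (A : set X) :=
  forall k, gamma k @` A `<=` A /\ gamma k @^-1` A `<=` A.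

Definition essentially_free :=
  forall k l : seq 'I_N, k <> l ->
    nowhere_dense [set x | comp_word k x = comp_word l x].

Definition ifs_graph : set (X * X) := [set p | exists k, p.1 = gamma k p.2].

(* The chain (x_n, ..., x_0) is the row vector x with x 0 i = x_i. *)
Definition is_chain (n : nat) (x : 'rV[X]_n.+1) :=
  forall i : 'I_n, exists k,
    x ord0 (lift ord0 i) = gamma k (x ord0 (widen_ord (leqnSn n) i)).

(* the chain x_i = gamma_(k_i, ..., k_1) x, where k = [:: k_n; ...; k_1] *)
Definition comp_chain (n : nat) (k : n.-tuple 'I_N) (x : X) : 'rV[X]_n.+1 :=
  \row_i comp_word (drop (n - i) k) x.

Definition chain_pairs (m n : nat) : set ('rV[X]_m.+1 * 'rV[X]_n.+1) :=
  [set p | [/\ is_chain p.1, is_chain p.2 & p.1 ord0 ord0 = p.2 ord0 ord0]].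

End ifs.

Arguments chain_pairs {X N} gamma m n.

Section ifs_operators.
Variables (R : realType) (X : topologicalType) (N : nat).
Variables (gamma : 'I_N -> X -> X) (XX : set X).
Local Notation H := (l2 R XX).
Local Notation Hhat := (l2 R (XX * int)%type).

(* e_x, for x in XX given as a point of X (the value off XX is a dummy) *)
Definition l2_basis_at (x : X) : H := oapp (@l2_basis R XX) 0 (insub x).

(* Elements of C(K), for K a subset of a space, are represented by functions
   on the whole space that are continuous on K. The operators are determined
   by their values on the basis vectors. *)

Definition is_rhoA (a : X -> R[i]^o) (T : H -> H) :=
  bounded_op T /\ forall x : XX, T (l2_basis R x) = a (val x) *: l2_basis R x.

Definition is_rhoE (f : X * X -> R[i]^o) (T : H -> H) :=
  bounded_op T /\ forall y : XX, T (l2_basis R y) =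
    \sum_(k < N) f (gamma k (val y), val y) *: l2_basis_at (gamma k (val y)).

(* is_rho f T : T = rho_(m,n)(f); a point y of gamma^n(XX) is given as
   gamma_k(x), for the unique k in I^n and x in XX. *)
Definition is_rho (m n : nat) (f : 'rV[X]_m.+1 * 'rV[X]_n.+1 -> R[i]^o)
    (T : H -> H) :=
  [/\ bounded_op T,
      forall (k : n.-tuple 'I_N) (x : XX),
        T (l2_basis_at (comp_word gamma k (val x))) =
        \sum_(j : m.-tuple 'I_N)
          f (comp_chain gamma j (val x), comp_chain gamma k (val x))
          *: l2_basis_at (comp_word gamma j (val x))
    & forall y : XX, ~ iter n (ifs_image gamma) XX (val y) ->
        T (l2_basis R y) = 0].

Definition hat_rhoA_range : set (Hhat -> Hhat) :=
  [set T | exists (a : X -> R[i]^o) T0,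
     [/\ continuous a, is_rhoA a T0 & is_tensor T0 (@l2_shift R 0) T]].

Definition hat_rhoE_range : set (Hhat -> Hhat) :=
  [set T | exists (f : X * X -> R[i]^o) T0,
     [/\ {within ifs_graph gamma, continuous f}, is_rhoE f T0
       & is_tensor T0 (@l2_shift R 1) T]].

Definition cstar_hat_rho : set (Hhat -> Hhat) :=
  cstar_generated (hat_rhoA_range `|` hat_rhoE_range).

Definition rho_range (m n : nat) : set (H -> H) :=
  [set T | exists2 f : 'rV[X]_m.+1 * 'rV[X]_n.+1 -> R[i]^o,
     {within chain_pairs gamma m n, continuous f} & is_rho f T].

Definition Bk (k : int) : set (H -> H) :=
  closed_span [set T | exists m n : nat,
     m%:Z - n%:Z = k /\ rho_range m n T].

Definition Dk (k : int) : set (H -> H) := Bk k `&` @diagonal_op R XX.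

Definition hatD : set (Hhat -> Hhat) :=
  closed_span [set T | exists k T0, Dk k T0 /\ is_tensor T0 (@l2_shift R k) T].

End ifs_operators.

Arguments hat_rhoA_range R {X} XX.
Arguments hat_rhoE_range R {X N} gamma XX.
Arguments cstar_hat_rho R {X N} gamma XX.
Arguments rho_range R {X N} gamma XX m n.
Arguments Bk R {X N} gamma XX k.
Arguments Dk R {X N} gamma XX k.
Arguments hatD R {X N} gamma XX.

(* Main.v *)
Require Import Defs.
From HB Require Import structures.
From mathcomp Require Import all_boot all_order all_algebra.
From mathcomp Require Import all_classical all_reals all_analysis.
From mathcomp Require Import perm complex ring lra zify.
Set Implicit Arguments.
Unset Strict Implicit.
Unset Printing Implicit Defensive.
Import Order.TTheory GRing.Theory Num.Theory.
Import numFieldNormedType.Exports.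
Local Open Scope classical_set_scope.
Local Open Scope ring_scope.
(* Write g_k for gamma_(k_n) o ... o gamma_(k_1). The matrix coefficients of an
   element of the *-algebra generated by the representation are described, near
   a point x, by finitely many continuous functions: the coefficient of degree d
   from g_k(x) to g_j(x), where |j| - |k| = d, is F j k x, as soon as k is long
   or x lies outside gamma(X). This form survives sums, products and adjoints.
   If a diagonal kernel is a limit of such kernels, then its part of degree d <> 0
   vanishes: words j, k of different lengths satisfy g_j(x') <> g_k(x') at points
   x' arbitrarily close to x, by essential freeness, and there the coefficients
   are small. Its part of degree 0 extends to a continuous function on X: the
   values F k k x of an approximant depend only on g_k(x), because F is invariant
   under the automorphisms of the tree of words that fix the points g_w(x), and
   the sets g_k(X) form a finite closed cover. An element of a commutative
   *-subalgebra containing C(X) is diagonal because it commutes with C(X). *)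

(** On [XX] a point and a length determine the word, because the images are disjoint there. The
    continuous symbol that is sought lives on all of X, where the images may overlap, so
    coefficients are recorded as functions of two words and a base point instead of two points. This
    makes each of them continuous in x, but their value may depend on the words chosen. Invariance
    under replacing one word alone fails already for rho_(m,n): on longer words its coefficient
    vanishes unless the two words share a tail, and replacing one of them can destroy that tail.
    Moving both words by one tree automorphism preserves common tails and permutes the intermediate
    words of a product, and it is still enough for the diagonal, where both words are equal. The map
    [sigma] strips letters: it recovers the base point from the length and the end point. Clopenness
    of gamma(X) enters twice: its openness makes the set of base points without a preimage compact,
    and its closedness lets such a base point move a little. *)

Local Notation normc := Normc.normc.
#[local] Arguments l2_fun : simpl never.

(** * Estimates for the complex modulus *)

Section complex_norm.
Variable R : realType.
Implicit Types z w : R[i].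

Lemma normc_normr z : `|z| = ((normc z)%:C)%C.
Proof. by []. Qed.

Lemma ler_normcD z w : normc (z + w) <= normc z + normc w.
Proof. exact: le_normcD. Qed.

Lemma normc_opp z : normc (- z) = normc z.
Proof. exact: normcN. Qed.

Lemma normc_distC z w : normc (z - w) = normc (w - z).
Proof. by rewrite -normc_opp opprB. Qed.

Lemma normc_conj z : normc (z^*) = normc z.
Proof. by apply: complexI; rewrite -!normc_normr norm_conjC. Qed.

Lemma normcP z w (e : R) : normc (z - w) <= e <-> `|z - w| <= (e%:C)%C.
Proof. by rewrite normc_normr lecR. Qed.

Lemma ler_normc_sum (I : Type) (s : seq I) (P : pred I) (F : I -> R[i]) :
  normc (\sum_(i <- s | P i) F i) <= \sum_(i <- s | P i) normc (F i).
Proof.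
elim/big_ind2: _ => [|z x w y zx wy|//]; first by rewrite Normc.normc0.
by apply: le_trans (ler_normcD _ _) _; apply: lerD.
Qed.

Lemma ler_norm_Re z : `|complex.Re z| <= normc z.
Proof. by rewrite -lecR -normc_normr normc_ge_Re. Qed.

Lemma ler_norm_Im z : `|complex.Im z| <= normc z.
Proof.
case: z => x y /=; rewrite -sqrtr_sqr ler_sqrt ?addr_ge0 ?sqr_ge0//.
by rewrite lerDr sqr_ge0.
Qed.

Lemma ler_normc_ReIm z : normc z <= `|complex.Re z| + `|complex.Im z|.
Proof.
case: z => x y /=; rewrite -(ger0_norm (addr_ge0 (normr_ge0 x) (normr_ge0 y))).
rewrite -sqrtr_sqr ler_sqrt ?sqr_ge0// sqrrD !real_normK ?num_real//.
by rewrite addrAC lerDl mulrn_wge0// mulr_ge0.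
Qed.

Lemma normc_eq0_le z : (forall e : R, 0 < e -> normc z <= e) -> z = 0.
Proof.
move=> ze; apply: Normc.eq0_normc; have z0 : normc z <= 0.
  by apply/ler_addgt0Pl => e e0; rewrite addr0 ze.
by apply: le_anti; apply/andP; split; [exact: z0|exact: normc_ge0].
Qed.

End complex_norm.

(** * Unconditional sums *)

Section has_sum.
Variables (R : realType) (S : choiceType).
Implicit Types (F G : S -> R[i]) (L : R[i]).

(** Convergence of the net of finite partial sums. Identities for [inner] then follow from
    uniqueness of the limit, without returning to the positive and negative parts in [abs_sum]. *)
Definition has_sum F L := forall e : R, 0 < e -> exists s : seq S,
  forall t, uniq t -> {subset s <= t} -> normc (\sum_(x <- t) F x - L) <= e.

Lemma has_sum_unique F L L' : has_sum F L -> has_sum F L' -> L = L'.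
Proof.
move=> FL FL'; apply/eqP; rewrite -subr_eq0; apply/eqP.
apply: normc_eq0_le => e e0.
have [s sL] := FL _ (divr_gt0 e0 (ltr0Sn _ 1)).
have [s' sL'] := FL' _ (divr_gt0 e0 (ltr0Sn _ 1)).
have ut := undup_uniq (s ++ s').
have := sL _ ut; have := sL' _ ut; set t := \sum_(x <- _) _ => /(_ _)H1 /(_ _)H2.
have -> : L - L' = (t - L') - (t - L) by ring.
apply: le_trans (ler_normcD _ _) _; rewrite normc_opp (splitr e) lerD//.
  by apply: H1 => x xs; rewrite mem_undup mem_cat xs orbT.
by apply: H2 => x xs; rewrite mem_undup mem_cat xs.
Qed.

Lemma has_sum_lin (c : R[i]) F G L L' : has_sum F L -> has_sum G L' ->
  has_sum (fun x => c * F x + G x) (c * L + L').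
Proof.
move=> FL GL' e e0; have c0 : 0 < normc c + 1.
  by rewrite ltr_wpDl ?normc_ge0.
have [s sL] := FL _ (divr_gt0 (divr_gt0 e0 (ltr0Sn _ 1)) c0).
have [s' sL'] := GL' _ (divr_gt0 e0 (ltr0Sn _ 1)).
exists (s ++ s') => t ut st; rewrite big_split/= -mulr_sumr.
have -> (a b : R[i]) : c * a + b - (c * L + L') = c * (a - L) + (b - L').
  by rewrite mulrBr; ring.
apply: le_trans (ler_normcD _ _) _; rewrite (splitr e) lerD//; last first.
  by apply: sL' => // x xs; apply: st; rewrite mem_cat xs orbT.
rewrite Normc.normcM; apply: (@le_trans _ _ ((normc c + 1) * (e / 2 / (normc c + 1)))).
  apply: ler_pM; rewrite ?normc_ge0 ?lerDl//.
  by apply: sL => // x xs; apply: st; rewrite mem_cat xs.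
by rewrite mulrC divfK// gt_eqF.
Qed.

Lemma has_sum_conj F L : has_sum F L -> has_sum (fun x => (F x)^*) (L^*).
Proof.
move=> FL e e0; have [s sL] := FL _ e0; exists s => t ut st.
by rewrite -rmorph_sum -rmorphB/= normc_conj sL.
Qed.

Lemma has_sum_le F L (M : R) : has_sum F L ->
  (forall s, uniq s -> normc (\sum_(x <- s) F x) <= M) -> normc L <= M.
Proof.
move=> FL FM; apply/ler_addgt0Pl => e e0; have [s sL] := FL _ e0.
have ut := undup_uniq s; have := sL _ ut; have := FM _ ut.
set t := \sum_(x <- _) _ => tM /(_ _)tL.
rewrite -[L](subKr t); apply: le_trans (ler_normcD _ _) _.
by rewrite normc_opp addrC lerD// tL// => x; rewrite mem_undup.
Qed.

Lemma esum_leP (f : S -> R) (M : R) :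
  (\esum_(s in [set: S]) (f s)%:E <= M%:E)%E <->
  (forall s : seq S, uniq s -> \sum_(x <- s) f x <= M).
Proof.
split=> [fM s us|fM].
  rewrite -lee_fin -sumEFin; apply: le_trans fM.
  apply: esum_ge; exists [set` s]; first by split.
  by rewrite fsbig_seq.
apply: ge_ereal_sup => _ [A [finA _] <-].
by rewrite fsbig_finite//= sumEFin lee_fin fM.
Qed.

Lemma ler_sum_subset (f : S -> R) (s t : seq S) : (forall x, 0 <= f x) ->
  uniq s -> uniq t -> {subset s <= t} -> \sum_(x <- s) f x <= \sum_(x <- t) f x.
Proof.
move=> f0 us ut st; rewrite [leRHS](bigID (mem s))/= -[leLHS]addr0 lerD//.
  rewrite -[leRHS]big_filter le_eqVlt; apply/orP; left; apply/eqP/perm_big.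
  apply: uniq_perm => //; first exact: filter_uniq.
  move=> x; rewrite mem_filter/=; case xs: (x \in s) => //=.
  by rewrite st.
by apply: sumr_ge0.
Qed.

Lemma esum_approx (f : S -> R) (M : R) : (forall x, 0 <= f x) ->
  (forall s, uniq s -> \sum_(x <- s) f x <= M) ->
  forall e : R, 0 < e -> exists s : seq S, forall t, uniq t -> {subset s <= t} ->
  `|\sum_(x <- t) f x - fine (\esum_(x in [set: S]) (f x)%:E)| <= e.
Proof.
move=> f0 fM e e0; have /esum_leP := fM.
set E := esum _ _ => EM.
have Efin : E \is a fin_num.
  rewrite ge0_fin_numE; first exact: le_lt_trans EM (ltry _).
  by apply: esum_ge0 => x _; rewrite lee_fin.
have Ele : forall t, uniq t -> \sum_(x <- t) f x <= fine E.
  by apply/esum_leP; rewrite fineK.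
suff [s us sE] : exists2 s, uniq s & fine E - e <= \sum_(x <- s) f x.
  exists s => t ut st; rewrite distrC ger0_norm ?subr_ge0 ?Ele//.
  rewrite lerBlDl -lerBlDr; apply: le_trans sE _.
  exact: ler_sum_subset.
apply: contrapT => nE.
have : (E <= (fine E - e)%:E)%E.
  apply/esum_leP => s us; apply/ltW; rewrite ltNge; apply/negP => sE.
  by apply: nE; exists s.
by rewrite -[X in (X <= _)%E](fineK Efin) lee_fin lerDl oppr_ge0 leNgt e0.
Qed.

Lemma abs_sum_approx (f : S -> R) (M : R) :
  (forall s, uniq s -> \sum_(x <- s) `|f x| <= M) ->
  forall e : R, 0 < e -> exists s : seq S, forall t, uniq t -> {subset s <= t} ->
  `|\sum_(x <- t) f x - abs_sum f| <= e.
Proof.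
move=> fM e e0.
have fp x : 0 <= f^\+ x by rewrite /funrpos le_max lexx orbT.
have fn x : 0 <= f^\- x by rewrite /funrneg le_max lexx orbT.
have fpM s : uniq s -> \sum_(x <- s) f^\+ x <= M.
  move=> us; apply: le_trans (fM s us); apply: ler_sum => x _.
  by rewrite /funrpos ge_max ler_norm normr_ge0.
have fnM s : uniq s -> \sum_(x <- s) f^\- x <= M.
  move=> us; apply: le_trans (fM s us); apply: ler_sum => x _.
  by rewrite /funrneg ge_max -normrN ler_norm normr_ge0.
have [s1 H1] := esum_approx fp fpM (divr_gt0 e0 (ltr0Sn _ 1)).
have [s2 H2] := esum_approx fn fnM (divr_gt0 e0 (ltr0Sn _ 1)).
exists (s1 ++ s2) => t ut st.
have -> : \sum_(x <- t) f x = \sum_(x <- t) f^\+ x - \sum_(x <- t) f^\- x.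
  rewrite -sumrB; apply: eq_bigr => x _.
  by rewrite -[f in LHS]funrposBneg.
have H1' : {subset s1 <= t} by move=> x xs; apply: st; rewrite mem_cat xs.
have H2' : {subset s2 <= t} by move=> x xs; apply: st; rewrite mem_cat xs orbT.
move: (H1 t ut H1') (H2 t ut H2'); rewrite /abs_sum.
move: (fine _) (fine _) => P Q {}H1' {}H2'.
move: H1' H2'; rewrite !ler_norml => /andP[H1' H1''] /andP[H2' H2''].
apply/andP; split; lra.
Qed.

End has_sum.

(** * The inner product of l2 and truncation of vectors *)

Section hilbert.
Variables (R : realType) (S : choiceType).
Local Notation H := (l2 R S).
Implicit Types (u v w : H) (s t : seq S).

Lemma l2_linE (c : R[i]) u v x : (c *: u + v) x = c * u x + v x.
Proof. by []. Qed.

Lemma l2_scaleE (c : R[i]) u x : (c *: u) x = c * u x.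
Proof. by []. Qed.

Lemma l2_subE u v x : (u - v) x = u x - v x.
Proof. by []. Qed.

Lemma l2_sumE (I : Type) (r : seq I) (P : pred I) (F : I -> H) x :
  (\sum_(i <- r | P i) F i) x = \sum_(i <- r | P i) F i x.
Proof. by elim/big_rec2: _ => // i a b _ <-. Qed.

Lemma l2_coord_le u x : normc (u x) <= l2norm u.
Proof.
have := @le_l2norm _ _ u [:: x] isT; rewrite big_seq1.
by rewrite ler_sqr// ?nnegrE ?normc_ge0 ?l2norm_ge0.
Qed.

Lemma l2norm_eq0_le u : (forall e : R, 0 < e -> l2norm u <= e) -> u = 0.
Proof.
move=> ue; apply: l2_ext => x; apply: normc_eq0_le => e /ue; apply: le_trans.
exact: l2_coord_le.
Qed.

Lemma l2normN u : l2norm (- u) = l2norm u.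
Proof. by rewrite -scaleN1r l2normZ normc_opp Normc.normc1 mul1r. Qed.

Lemma l2normB u v : l2norm (u - v) <= l2norm u + l2norm v.
Proof. by rewrite -(l2normN v) l2normD. Qed.

Lemma l2norm0 : l2norm (0 : H) = 0.
Proof. by rewrite -(scale0r 0) l2normZ Normc.normc0 mul0r. Qed.

(** Termwise, the right side is at least twice the product of the moduli; one of the two copies is
    given away. The free weight [k] is what yields a product of norms in [inner_le]. *)
Lemma mul_sum_normc_le u v (k : R) s : 0 < k -> uniq s ->
  \sum_(x <- s) normc ((u x)^* * v x) <=
  k * l2norm u ^+ 2 + k^-1 * l2norm v ^+ 2.
Proof.
move=> k0 us; apply: (@le_trans _ _ (\sum_(x <- s)
    (k * normc (u x) ^+ 2 + k^-1 * normc (v x) ^+ 2))).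
  apply: ler_sum => x _; rewrite Normc.normcM normc_conj.
  move: (normc (u x)) (normc (v x)) (normc_ge0 (u x)) (normc_ge0 (v x)) => a b a0 b0.
  have -> : k * a ^+ 2 + k^-1 * b ^+ 2 = a * b + (a * b + k^-1 * (k * a - b) ^+ 2).
    by field; rewrite gt_eqF.
  rewrite lerDl; apply: addr_ge0; first exact: mulr_ge0.
  by apply: mulr_ge0; [rewrite invr_ge0 ltW|exact: sqr_ge0].
rewrite big_split/= -!mulr_sumr; apply: lerD.
  by rewrite ler_wpM2l ?le_l2norm// ltW.
by rewrite ler_wpM2l ?le_l2norm// invr_ge0 ltW.
Qed.

Lemma inner_has_sum u v : has_sum (fun x => (u x)^* * v x) (inner u v).
Proof.
set F := fun x => _.
have FM s : uniq s -> \sum_(x <- s) normc (F x) <= l2norm u ^+ 2 + l2norm v ^+ 2.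
  by move=> us; have := mul_sum_normc_le u v ltr01 us; rewrite invr1 !mul1r.
have ReM s : uniq s -> \sum_(x <- s) `|complex.Re (F x)| <= l2norm u ^+ 2 + l2norm v ^+ 2.
  by move=> /FM; apply: le_trans; apply: ler_sum => x _; exact: ler_norm_Re.
have ImM s : uniq s -> \sum_(x <- s) `|complex.Im (F x)| <= l2norm u ^+ 2 + l2norm v ^+ 2.
  by move=> /FM; apply: le_trans; apply: ler_sum => x _; exact: ler_norm_Im.
move=> e e0.
have [s1 H1] := abs_sum_approx ReM (divr_gt0 e0 (ltr0Sn _ 1)).
have [s2 H2] := abs_sum_approx ImM (divr_gt0 e0 (ltr0Sn _ 1)).
exists (s1 ++ s2) => t ut st.
have ReS : complex.Re (\sum_(x <- t) F x) = \sum_(x <- t) complex.Re (F x).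
  by elim/big_rec2: _ => // x a [b c] _ <- /=; case: (F x).
have ImS : complex.Im (\sum_(x <- t) F x) = \sum_(x <- t) complex.Im (F x).
  by elim/big_rec2: _ => // x a [b c] _ <- /=; case: (F x).
apply: le_trans (ler_normc_ReIm _) _; rewrite (splitr e).
move: ReS ImS; case: (\sum_(x <- t) F x) => a b /= -> ->; apply: lerD.
  by apply: H1 => // x xs; apply: st; rewrite mem_cat xs.
by apply: H2 => // x xs; apply: st; rewrite mem_cat xs orbT.
Qed.

Lemma inner_linr w (c : R[i]) u v :
  inner w (c *: u + v) = c * inner w u + inner w v.
Proof.
apply: has_sum_unique (inner_has_sum _ _) _.
have := has_sum_lin c (inner_has_sum w u) (inner_has_sum w v).
by congr has_sum; apply/funext => x; rewrite l2_linE; ring.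
Qed.

Lemma inner_conj u v : inner v u = (inner u v)^*.
Proof.
apply: has_sum_unique (inner_has_sum _ _) _.
have := has_sum_conj (inner_has_sum u v).
by congr has_sum; apply/funext => x; rewrite rmorphM/= conjCK mulrC.
Qed.

Lemma inner_linl w (c : R[i]) u v :
  inner (c *: u + v) w = c^* * inner u w + inner v w.
Proof. by rewrite inner_conj inner_linr rmorphD rmorphM/= -!inner_conj. Qed.

Lemma inner0r u : inner u 0 = 0.
Proof. by have := inner_linr u (-1) 0 0; rewrite scaler0 addr0 mulN1r addNr. Qed.

Lemma inner0l u : inner 0 u = 0.
Proof. by rewrite inner_conj inner0r conjC0. Qed.

Lemma innerBl u v w : inner (u - v) w = inner u w - inner v w.
Proof. by rewrite addrC -scaleN1r inner_linl rmorphN1 mulN1r addrC. Qed.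

Lemma innerBr u v w : inner w (u - v) = inner w u - inner w v.
Proof. by rewrite addrC -scaleN1r inner_linr mulN1r addrC. Qed.

Lemma inner_suml (I : Type) (r : seq I) (c : I -> R[i]) (F : I -> H) w :
  inner (\sum_(i <- r) c i *: F i) w = \sum_(i <- r) (c i)^* * inner (F i) w.
Proof.
elim/big_rec2: _ => [|i a b _ <-]; first exact: inner0l.
by rewrite inner_linl.
Qed.

Lemma l2_basisE (x y : S) : l2_basis R x y = (y == x)%:R.
Proof. by []. Qed.

Lemma inner_basisl x v : inner (l2_basis R x) v = v x.
Proof.
apply: has_sum_unique (inner_has_sum _ _) _ => e e0; exists [:: x] => t ut st.
rewrite (bigD1_seq x)//=; last by apply: st; rewrite mem_seq1.
rewrite l2_basisE eqxx conjC1 mul1r big1 => [|y /negPf yx].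
  by rewrite addr0 subrr Normc.normc0 ltW.
by rewrite l2_basisE yx conjC0 mul0r.
Qed.

Lemma inner_basisr u x : inner u (l2_basis R x) = (u x)^*.
Proof. by rewrite inner_conj inner_basisl. Qed.

Lemma inner_self u : l2norm u ^+ 2 <= normc (inner u u).
Proof.
rewrite -(sqr_sqrtr (normc_ge0 _)) ler_sqr ?nnegrE ?l2norm_ge0 ?sqrtr_ge0//.
apply/l2normP => [|s us]; first exact: sqrtr_ge0.
rewrite (sqr_sqrtr (normc_ge0 _)); apply/ler_addgt0Pl => e e0.
have [s0 H0] := inner_has_sum u u e0.
have [t [ts ts0 ut']] : exists t, [/\ {subset s <= t}, {subset s0 <= t} & uniq t].
  exists (undup (s ++ s0)); split=> [x|x|]; rewrite ?undup_uniq// mem_undup mem_cat => ->//.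
  exact: orbT.
have := ler_sum_subset (fun x => sqr_ge0 (normc (u x))) us ut' ts.
move/le_trans; apply; have := H0 _ ut' ts0.
have -> : \sum_(x <- t) (u x)^* * u x = ((\sum_(x <- t) normc (u x) ^+ 2)%:C)%C.
  rewrite rmorph_sum; apply: eq_bigr => x _.
  by rewrite mulrC -normCK normc_normr rmorphXn.
set a := \sum_(x <- t) _ => ae; rewrite -[a]ger0_norm ?sumr_ge0// => [|x _]; last first.
  exact: sqr_ge0.
apply: le_trans (ler_norm_Re (a%:C)%C) _.
rewrite -[X in normc X](subrK (inner u u)); apply: le_trans (ler_normcD _ _) _.
by rewrite lerD2r.
Qed.

(** Cauchy-Schwarz up to the factor 2 lost in [mul_sum_normc_le], whose two terms are balanced by
    the weight [l2norm v / l2norm u]. *)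
Lemma inner_le u v : normc (inner u v) <= 2 * (l2norm u * l2norm v).
Proof.
have [/l2norm0_eq0 ->|u0] := eqVneq (l2norm u) 0.
  by rewrite inner0l Normc.normc0 !mulr_ge0 ?l2norm_ge0.
have [/l2norm0_eq0 ->|v0] := eqVneq (l2norm v) 0.
  by rewrite inner0r Normc.normc0 !mulr_ge0 ?l2norm_ge0.
have pu : 0 < l2norm u by rewrite lt_def u0 l2norm_ge0.
have pv : 0 < l2norm v by rewrite lt_def v0 l2norm_ge0.
apply: has_sum_le (inner_has_sum u v) _ => s us.
apply: le_trans (ler_normc_sum _ _ _) _.
apply: le_trans (mul_sum_normc_le u v (divr_gt0 pv pu) us) _.
rewrite le_eqVlt; apply/orP; left; apply/eqP; field.
by rewrite u0 v0.
Qed.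

Lemma l2_sum_basisE (c : S -> R[i]) s y : uniq s ->
  (\sum_(x <- s) c x *: l2_basis R x) y = if y \in s then c y else 0.
Proof.
move=> us; rewrite l2_sumE; case: ifPn => ys; last first.
  rewrite big1_seq// => x /andP[_ xs].
  have /negPf yx : y != x by apply: contraNneq ys => ->.
  by rewrite l2_scaleE l2_basisE yx mulr0.
rewrite (bigD1_seq y)// big1 => [|x /negPf yx].
  by rewrite l2_scaleE l2_basisE eqxx mulr1 /= addr0.
by rewrite l2_scaleE l2_basisE eq_sym yx mulr0.
Qed.

Lemma l2_trunc u (e : R) : 0 < e -> exists2 s, uniq s &
  l2norm (u - \sum_(x <- s) u x *: l2_basis R x) <= e.
Proof.
move=> e0; have := @le_l2norm _ _ u => uM.
have e2 : 0 < e ^+ 2 / 2 by rewrite divr_gt0// exprn_gt0.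
have [s0 H0] := esum_approx (fun x => sqr_ge0 (normc (u x))) uM e2.
move: H0; set L := fine _ => H0.
exists (undup s0); first exact: undup_uniq.
set s := undup s0; have us : uniq s := undup_uniq _.
apply/l2normP => [|t ut]; first exact: ltW.
set f := fun x => normc (u x) ^+ 2.
(* The remainder lives on the part of [t] outside [s]. Its mass is the difference of the sums over
   this enlarged list and over [s], both within [e ^+ 2 / 2] of the total mass. *)
have ur : uniq (s ++ [seq x <- t | x \notin s]).
  rewrite cat_uniq us filter_uniq// andbT; apply/hasPn => x.
  by rewrite mem_filter => /andP[].
have sr : {subset s0 <= s ++ [seq x <- t | x \notin s]}.
  by move=> x xs; rewrite mem_cat mem_undup xs.
have -> : \sum_(x <- t) normc ((u - \sum_(x <- s) u x *: l2_basis R x) x) ^+ 2 =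
    \sum_(x <- [seq x <- t | x \notin s]) f x.
  rewrite big_filter [RHS]big_mkcond/=; apply: eq_bigr => x _.
  rewrite l2_subE l2_sum_basisE//; case: ifP => xs /=.
    by rewrite subrr Normc.normc0 expr0n.
  by rewrite subr0.
have := H0 _ ur sr; rewrite big_cat/= -/f => H1.
have := H0 s us; rewrite -/f => /(_ _)H2.
have {}H2 : `|\sum_(x <- s) f x - L| <= e ^+ 2 / 2.
  by apply: H2 => x; rewrite mem_undup.
move: H1 H2; rewrite !ler_norml; set a := \sum_(x <- s) _; set b := \sum_(x <- _) _.
move=> /andP[_ H1] /andP[H2 _]; lra.
Qed.

End hilbert.

(** * Bounded operators, adjoints and norm closures *)

Section bounded_operators.
Variables (R : realType) (S : choiceType).
Local Notation H := (l2 R S).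
Implicit Types (u v w : H) (T : H -> H) (B : set (H -> H)).

Lemma bounded_opP T : bounded_op T <-> linear T /\
  exists2 C : R, 0 <= C & forall u, l2norm (T u) <= C * l2norm u.
Proof.
split=> -[lT].
  pose LT := GRing.isLinear.Build _ _ _ _ T lT.
  pose T' : {linear H -> H} := HB.pack T LT.
  move=> cT; split=> //.
  have /linear_bounded_continuous/linear_boundedP : continuous T' by [].
  move=> /pinfty_ex_gt0[r r0 Tr]; exists (complex.Re r) => [|u].
    by move: r0; rewrite ltcE => /andP[_ /ltW].
  have := Tr u; rewrite !l2_normE lecE => /andP[_] /=.
  by case: r {r0 Tr} => a b /=; rewrite mulr0 subr0.
pose LT := GRing.isLinear.Build _ _ _ _ T lT.
pose T' : {linear H -> H} := HB.pack T LT.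
move=> [C C0 TC]; split=> //.
suff : continuous T' by [].
apply/linear_bounded_continuous/linear_boundedP.
exists (C%:C)%C; split; first by rewrite complex_real.
move=> r Cr u; rewrite !l2_normE; apply: (@le_trans _ _ ((C%:C)%C * ((l2norm u)%:C)%C)).
  by rewrite -rmorphM lecR TC.
by rewrite ler_wpM2r ?lecR ?l2norm_ge0// ltW.
Qed.

End bounded_operators.

Section operator_algebra.
Variables (R : realType) (S : choiceType).
Local Notation H := (l2 R S).
Implicit Types (u v w : H) (T : H -> H) (B : set (H -> H)).

Lemma bounded_op_sum T (I : Type) (r : seq I) (c : I -> R[i]) (F : I -> H) :
  bounded_op T -> T (\sum_(i <- r) c i *: F i) = \sum_(i <- r) c i *: T (F i).
Proof.
move=> [lT _].
have T0 : T 0 = 0 by have := lT (-1) 0 0; rewrite scaler0 addr0 scaleN1r addNr.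
by elim/big_rec2: _ => [//|i a b _ <-]; rewrite lT.
Qed.

Lemma bounded_opZ T (c : R[i]) u : bounded_op T -> T (c *: u) = c *: T u.
Proof.
by move=> /(bounded_op_sum [:: tt] (fun=> c) (fun=> u)); rewrite !big_seq1.
Qed.

Lemma bounded_opB T u v : bounded_op T -> T (u - v) = T u - T v.
Proof. by move=> [lT _]; rewrite addrC -scaleN1r lT scaleN1r addrC. Qed.

Lemma bounded_op_comb (c : R[i]) T T' : bounded_op T -> bounded_op T' ->
  bounded_op (c *: T + T').
Proof.
move=> /bounded_opP[lT [C C0 TC]] /bounded_opP[lT' [C' C0' TC']].
apply/bounded_opP; split.
  move=> d u v; rewrite -[LHS]/(c *: T (d *: u + v) + T' (d *: u + v)) lT lT'.
  rewrite -[RHS]/(d *: (c *: T u + T' u) + (c *: T v + T' v)) !scalerDr !scalerA.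
  by rewrite (mulrC c) !addrA; congr (_ + _); rewrite -!addrA; congr (_ + _); exact: addrC.
exists (normc c * C + C') => [|u].
  by rewrite addr_ge0// mulr_ge0// normc_ge0.
rewrite -[X in l2norm X]/(c *: T u + T' u) mulrDl; apply: le_trans (l2normD _ _) _.
by rewrite lerD// l2normZ -mulrA ler_wpM2l ?normc_ge0.
Qed.

Lemma bounded_op0 : bounded_op (0 : H -> H).
Proof.
apply/bounded_opP; split=> [c u v|]; first by rewrite -[RHS]/(c *: 0 + 0) scaler0 addr0.
by exists 0 => // u; rewrite mul0r -[X in l2norm X]/(0 : H) l2norm0.
Qed.

Lemma bounded_op_comp T T' : bounded_op T -> bounded_op T' -> bounded_op (T \o T').
Proof.
move=> /bounded_opP[lT [C C0 TC]] /bounded_opP[lT' [C' C0' TC']].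
apply/bounded_opP; split=> [c u v|]; first by rewrite /= lT' lT.
exists (C * C') => [|u]; first exact: mulr_ge0.
by rewrite -mulrA; apply: le_trans (TC _) _; rewrite ler_wpM2l.
Qed.

Lemma bounded_op_ext T T' : bounded_op T -> bounded_op T' ->
  (forall x, T (l2_basis R x) = T' (l2_basis R x)) -> T = T'.
Proof.
move=> bT bT' TT'; apply/funext => u; apply/eqP; rewrite -subr_eq0; apply/eqP.
have [_ [C C0 TC]] := (bounded_opP _).1 bT.
have [_ [C' C0' TC']] := (bounded_opP _).1 bT'.
apply: l2norm_eq0_le => e e0; have D0 : 0 < C + C' + 1.
  by rewrite ltr_wpDl// addr_ge0.
have [s us us'] := l2_trunc u (divr_gt0 e0 D0); set w := \sum_(x <- s) _ in us'.
have -> : T u - T' u = T (u - w) - T' (u - w).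
  have -> : T (u - w) = T u - T w by exact: bounded_opB.
  have -> : T' (u - w) = T' u - T' w by exact: bounded_opB.
  have -> : T w = T' w.
    by rewrite !bounded_op_sum//; apply: eq_bigr => x _; rewrite TT'.
  by rewrite opprB addrA subrK.
apply: le_trans (l2normB _ _) _; apply: (@le_trans _ _ ((C + C' + 1) * l2norm (u - w))).
  by rewrite !mulrDl mul1r -[leLHS]addr0 !lerD ?l2norm_ge0.
apply: (@le_trans _ _ ((C + C' + 1) * (e / (C + C' + 1)))).
  by rewrite ler_wpM2l// ltW.
by rewrite mulrC divfK// gt_eqF.
Qed.

Lemma l2norm_sum_basis (c : S -> R[i]) (s : seq S) (M : R) : uniq s -> 0 <= M ->
  \sum_(x <- s) normc (c x) ^+ 2 <= M ^+ 2 ->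
  l2norm (\sum_(x <- s) c x *: l2_basis R x) <= M.
Proof.
move=> us M0 cM; apply/l2normP => // t ut; apply: le_trans cM.
under eq_bigr do rewrite l2_sum_basisE//.
rewrite (eq_bigr (fun x => if x \in s then normc (c x) ^+ 2 else 0)); last first.
  by move=> x _; case: ifP => //; rewrite Normc.normc0 expr0n.
rewrite -big_mkcond -big_filter; apply: ler_sum_subset => //.
- by move=> x; exact: sqr_ge0.
- exact: filter_uniq.
- by move=> x; rewrite mem_filter => /andP[].
Qed.

(** Duality: let A be the sum to be bounded and w the vector on [s] with these inner products as
    coefficients. Then <T w, v> = A and |w| <= sqrt A, so A <= 2 C |v| sqrt A. *)
Lemma adjoint_subproof T (C : R) v : bounded_op T -> 0 <= C ->
  (forall u, l2norm (T u) <= C * l2norm u) -> forall s : seq S, uniq s ->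
  \sum_(x <- s) normc (inner (T (l2_basis R x)) v) ^+ 2 <= (2 * C * l2norm v) ^+ 2.
Proof.
move=> bT C0 TC s us; pose c x := inner (T (l2_basis R x)) v.
set A := \sum_(x <- s) _; have A0 : 0 <= A by apply: sumr_ge0 => x _; exact: sqr_ge0.
pose w := \sum_(x <- s) c x *: l2_basis R x.
have wA : l2norm w <= Num.sqrt A.
  by apply: l2norm_sum_basis; rewrite ?sqrtr_ge0// sqr_sqrtr.
have Tw : inner (T w) v = (A%:C)%C.
  rewrite bounded_op_sum// inner_suml rmorph_sum; apply: eq_bigr => x _.
  by rewrite mulrC -normCK normc_normr rmorphXn.
have := inner_le (T w) v; rewrite Tw.
have -> : normc ((A%:C)%C) = A by rewrite /= expr0n addr0 sqrtr_sqr ger0_norm.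
move=> Ale; have {}Ale : A <= 2 * C * l2norm v * Num.sqrt A.
  apply: le_trans Ale _.
  have -> : 2 * C * l2norm v * Num.sqrt A = 2 * (C * Num.sqrt A * l2norm v) by ring.
  rewrite ler_wpM2l// ler_wpM2r ?l2norm_ge0//; apply: le_trans (TC _) _.
  by rewrite ler_wpM2l.
have [->|An0] := eqVneq A 0; first exact: sqr_ge0.
have sA : 0 < Num.sqrt A by rewrite sqrtr_gt0 lt_def An0.
rewrite -(sqr_sqrtr A0) ler_sqr ?nnegrE ?sqrtr_ge0 ?mulr_ge0 ?l2norm_ge0//.
by rewrite -(ler_pM2r sA) -expr2 sqr_sqrtr.
Qed.

Lemma adjoint_exists T : bounded_op T ->
  exists2 T', bounded_op T' & is_adjoint T T'.
Proof.
move=> bT; have [lT [C C0 TC]] := (bounded_opP _).1 bT.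
have K v := adjoint_subproof v bT C0 TC.
have ss v : (fun x => inner (T (l2_basis R x)) v) \in @square_summable R S.
  by apply/square_summableP; eexists; exact: K.
pose T' v := L2 (ss v).
have T'C v : l2norm (T' v) <= 2 * C * l2norm v.
  by apply/l2normP => [|s us]; [rewrite !mulr_ge0 ?l2norm_ge0|exact: K].
have bT' : bounded_op T'.
  apply/bounded_opP; split=> [c u v|].
    by apply: l2_ext => x; rewrite l2_linE -[LHS]/(inner _ _) inner_linr.
  by exists (2 * C) => //; exact: mulr_ge0.
exists T' => // u v; apply/eqP; rewrite -subr_eq0; apply/eqP.
apply: normc_eq0_le => e e0.
(* The 6 is 2 from [inner_le] for the first term, plus 2 * 2 for the second, where [T'] is bounded
   by 2 C. The 1 keeps the divisor positive. *)
have D0 : 0 < 6 * C * l2norm v + 1 by rewrite ltr_wpDl// !mulr_ge0 ?l2norm_ge0.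
have [s us us'] := l2_trunc u (divr_gt0 e0 D0); set w := \sum_(x <- s) _ in us'.
have -> : inner (T u) v - inner u (T' v) = inner (T (u - w)) v - inner (u - w) (T' v).
  rewrite bounded_opB// !innerBl.
  have -> : inner (T w) v = inner w (T' v).
    rewrite bounded_op_sum// !inner_suml; apply: eq_bigr => x _.
    by rewrite inner_basisl.
  by rewrite opprB addrA subrK.
apply: le_trans (ler_normcD _ _) _; rewrite normc_opp.
apply: (@le_trans _ _ (2 * (C * l2norm (u - w) * l2norm v)
    + 2 * (l2norm (u - w) * (2 * C * l2norm v)))).
  apply: lerD; apply: le_trans (inner_le _ _) _; rewrite ler_wpM2l//.
    by rewrite ler_wpM2r ?l2norm_ge0.
  by rewrite ler_wpM2l ?l2norm_ge0.
have -> : 2 * (C * l2norm (u - w) * l2norm v) + 2 * (l2norm (u - w) * (2 * C * l2norm v))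
   = 6 * C * l2norm v * l2norm (u - w) by ring.
apply: (@le_trans _ _ ((6 * C * l2norm v + 1) * (e / (6 * C * l2norm v + 1)))).
  by apply: ler_pM; rewrite ?mulr_ge0 ?l2norm_ge0// lerDl.
by rewrite mulrC divfK// gt_eqF.
Qed.

Lemma adjoint_coef T T' x y : is_adjoint T T' ->
  T' (l2_basis R y) x = (T (l2_basis R x) y)^*.
Proof. by move=> TT'; rewrite -inner_basisl -TT' inner_basisr. Qed.

Lemma adjoint_opnorm T T' (C : R) : 0 <= C -> bounded_op T' -> is_adjoint T T' ->
  (forall u, l2norm (T u) <= C * l2norm u) ->
  forall v, l2norm (T' v) <= 2 * C * l2norm v.
Proof.
move=> C0 bT' TT' TC v; have := inner_self (T' v).
rewrite -TT' => T'v; have {}T'v : l2norm (T' v) ^+ 2 <= 2 * C * l2norm v * l2norm (T' v).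
  apply: le_trans T'v _; apply: le_trans (inner_le _ _) _.
  have -> : 2 * C * l2norm v * l2norm (T' v) = 2 * (C * l2norm (T' v) * l2norm v) by ring.
  by rewrite ler_wpM2l// ler_wpM2r ?l2norm_ge0.
have [->|T'v0] := eqVneq (l2norm (T' v)) 0; first by rewrite !mulr_ge0 ?l2norm_ge0.
have p0 : 0 < l2norm (T' v) by rewrite lt_def T'v0 l2norm_ge0.
by rewrite -(ler_pM2r p0) -expr2.
Qed.

Lemma op_closureP B T : op_closure B T <-> bounded_op T /\
  forall e : R, 0 < e -> exists2 T', B T' & forall u, l2norm (T u - T' u) <= e * l2norm u.
Proof.
split=> -[bT BT]; split=> // e e0.
  have [|T' BT' TT'] := BT (e%:C)%C; first by rewrite ltcR.
  by exists T' => // u; have := TT' u; rewrite !l2_normE -rmorphM lecR.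
have e0' : 0 < complex.Re e by move: e0; rewrite ltcE => /andP[].
have eE : e = ((complex.Re e)%:C)%C.
  by move: e0; rewrite ltcE; case: (e) => a b /= /andP[/eqP ->].
have [T' BT' TT'] := BT _ e0'; exists T' => // u.
by rewrite eE !l2_normE -rmorphM lecR TT'.
Qed.

Lemma subset_op_closure B : B `<=` @bounded_op R S -> B `<=` op_closure B.
Proof.
move=> Bb T BT; apply/op_closureP; split=> [|e e0]; first exact: Bb.
by exists T => // u; rewrite subrr l2norm0 mulr_ge0 ?l2norm_ge0// ltW.
Qed.

Lemma op_closure_idem B : op_closure (op_closure B) `<=` op_closure B.
Proof.
move=> T /op_closureP[bT BT]; apply/op_closureP; split=> // e e0.
have [T1 /op_closureP[_ /(_ _ (divr_gt0 e0 (ltr0Sn _ 1)))[T2 BT2 H2]] H1] :=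
  BT _ (divr_gt0 e0 (ltr0Sn _ 1)).
exists T2 => // u; have -> : T u - T2 u = (T u - T1 u) + (T1 u - T2 u).
  by rewrite addrA subrK.
by rewrite (splitr e) mulrDl; apply: le_trans (l2normD _ _) _; rewrite lerD.
Qed.

Lemma op_closure_subspace B : B `<=` @bounded_op R S -> op_subspace B ->
  op_subspace (op_closure B).
Proof.
move=> Bb [B0 BD]; split; first exact: subset_op_closure.
move=> c T1 T2 /op_closureP[b1 H1] /op_closureP[b2 H2]; apply/op_closureP.
split=> [|e e0]; first exact: bounded_op_comb.
have c0 : 0 < normc c + 1 by rewrite ltr_wpDl// normc_ge0.
have [T1' BT1 H1'] := H1 _ (divr_gt0 (divr_gt0 e0 (ltr0Sn _ 1)) c0).
have [T2' BT2 H2'] := H2 _ (divr_gt0 e0 (ltr0Sn _ 1)).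
exists (c *: T1' + T2') => [|u]; first exact: BD.
have -> : (c *: T1 + T2) u - (c *: T1' + T2') u = c *: (T1 u - T1' u) + (T2 u - T2' u).
  rewrite -[LHS]/((c *: T1 u + T2 u) - (c *: T1' u + T2' u)) scalerBr.
  by rewrite opprD addrACA.
apply: le_trans (l2normD _ _) _; rewrite l2normZ {1}(splitr e) mulrDl lerD//.
apply: (@le_trans _ _ ((normc c + 1) * (e / 2 / (normc c + 1) * l2norm u))).
  by apply: ler_pM; rewrite ?normc_ge0 ?l2norm_ge0 ?lerDl.
by rewrite mulrA [_ * (e / 2 / _)]mulrC divfK// gt_eqF.
Qed.

(* The adjoint of a limit is a limit of adjoints, since bounded operators on
   l2 have adjoints. *)
Lemma op_closure_cstar B : star_subalgebra B -> cstar_subalgebra (op_closure B).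
Proof.
move=> [Bb [B0 BD] BM BA]; split; last exact: op_closure_idem; split.
- by move=> T [].
- exact: op_closure_subspace.
- move=> T1 T2 /op_closureP[b1 H1] /op_closureP[b2 H2]; apply/op_closureP.
  split=> [|e e0]; first exact: bounded_op_comp.
  have [_ [C2 C20 TC2]] := (bounded_opP _).1 b2.
  have C2' : 0 < C2 + 1 by rewrite ltr_wpDl.
  have [T1' BT1 H1'] := H1 _ (divr_gt0 (divr_gt0 e0 (ltr0Sn _ 1)) C2').
  have [lT1' [C1 C10 TC1]] := (bounded_opP _).1 (Bb _ BT1).
  have C1' : 0 < C1 + 1 by rewrite ltr_wpDl.
  have [T2' BT2 H2'] := H2 _ (divr_gt0 (divr_gt0 e0 (ltr0Sn _ 1)) C1').
  exists (T1' \o T2') => [|u]; first exact: BM.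
  have -> : (T1 \o T2) u - (T1' \o T2') u =
      (T1 (T2 u) - T1' (T2 u)) + T1' (T2 u - T2' u).
    by rewrite bounded_opB ?addrA ?subrK//; exact: Bb.
  apply: le_trans (l2normD _ _) _; rewrite (splitr e) mulrDl lerD//.
    apply: le_trans (H1' _) _.
    apply: (@le_trans _ _ (e / 2 / (C2 + 1) * ((C2 + 1) * l2norm u))).
      rewrite ler_wpM2l//; first by rewrite ltW// !divr_gt0.
      apply: le_trans (TC2 _) _; rewrite ler_wpM2r ?l2norm_ge0//.
      by rewrite lerDl.
    by rewrite mulrA divfK// gt_eqF.
  apply: le_trans (TC1 _) _.
  apply: (@le_trans _ _ ((C1 + 1) * (e / 2 / (C1 + 1) * l2norm u))).
    by apply: ler_pM; rewrite ?l2norm_ge0// lerDl.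
  by rewrite mulrA [_ * (e / 2 / _)]mulrC divfK// gt_eqF.
- move=> T T' /op_closureP[bT HT] bT' TT'; apply/op_closureP; split=> // e e0.
  have [T1 BT1 H1] := HT _ (divr_gt0 e0 (ltr0Sn _ 1)).
  have [T1' bT1' T1T1'] := adjoint_exists (Bb _ BT1).
  exists T1' => [|v]; first exact: BA BT1 bT1' T1T1'.
  have bD : bounded_op (fun u => T' u - T1' u).
    have -> : (fun u => T' u - T1' u) = (-1) *: T1' + T'.
      by apply/funext => u; rewrite addrC -scaleN1r.
    exact: bounded_op_comb.
  have aD : is_adjoint (fun u => T u - T1 u) (fun u => T' u - T1' u).
    by move=> u w; rewrite innerBl innerBr TT' T1T1'.
  have := adjoint_opnorm (ltW (divr_gt0 e0 (ltr0Sn _ 1))) bD aD H1 v.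
  by have -> : 2 * (e / 2) = e by field.
Qed.

Lemma mul_op_exists (g : S -> R[i]) (M : R) : (forall x, normc (g x) <= M) ->
  exists2 T, bounded_op T & forall u x, T u x = g x * u x.
Proof.
(* An empty [S] is split off because only a point of [S] forces [M] to be nonnegative. *)
move=> gM; have [[x0]|noS] := pselect (inhabited S); last first.
  exists 0 => [|u x]; first exact: bounded_op0.
  by exfalso; apply: noS.
have M0 : 0 <= M by apply: le_trans (gM x0); exact: normc_ge0.
have K u (s : seq S) : uniq s ->
    \sum_(x <- s) normc (g x * u x) ^+ 2 <= (M * l2norm u) ^+ 2.
  move=> us; rewrite exprMn; apply: (@le_trans _ _ (\sum_(x <- s) M ^+ 2 * normc (u x) ^+ 2)).
    apply: ler_sum => x _; rewrite Normc.normcM exprMn ler_wpM2r ?sqr_ge0//.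
    by rewrite ler_sqr ?nnegrE ?normc_ge0.
  by rewrite -mulr_sumr ler_wpM2l ?sqr_ge0// le_l2norm.
have ss u : (fun x => g x * u x) \in @square_summable R S.
  by apply/square_summableP; eexists; exact: K.
exists (fun u => L2 (ss u)) => //; apply/bounded_opP; split=> [c u v|].
  apply: l2_ext => x; rewrite l2_linE.
  by rewrite -[LHS]/(g x * (c *: u + v) x) l2_linE mulrDr mulrCA.
exists M => // u; apply/l2normP => [|s us]; last exact: K.
by rewrite mulr_ge0 ?l2norm_ge0.
Qed.

End operator_algebra.

(** * Words, base points and tree automorphisms *)

Section words.
Variables (X : Type) (N : nat) (gamma : 'I_N -> X -> X) (sigma : X -> X).
Variable XX : set X.
Hypothesis sigmaK : forall k x, sigma (gamma k x) = x.
Hypothesis XX_inv : forall k, gamma k @` XX `<=` XX /\ gamma k @^-1` XX `<=` XX.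
Hypothesis XX_disj : trivIset [set: 'I_N] (fun k => gamma k @` XX).
Local Notation word := (seq 'I_N).
Local Notation cw := (fun k x => foldr gamma x k).
Implicit Types (j k w : word) (x y : X).

Lemma comp_word_cat j k x : cw (j ++ k) x = cw j (cw k x).
Proof. exact: foldr_cat. Qed.

Lemma iter_sigmaK k x : iter (size k) sigma (cw k x) = x.
Proof. by elim: k => //= c k ih; rewrite -iterS iterSr sigmaK ih. Qed.

Lemma comp_word_in k x : XX x -> XX (cw k x).
Proof. by move=> XXx; elim: k => //= c k ih; apply: (XX_inv c).1; exists (foldr gamma x k). Qed.

Lemma comp_word_sizeI j k x y : size j = size k -> cw j x = cw k y -> x = y.
Proof. by move=> jk e; rewrite -[x](iter_sigmaK j) jk e iter_sigmaK. Qed.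

(** [sigma] removes the outer letters, and disjointness of the images of [XX] identifies them. Over
    base points outside [XX] two words may share a value; [tree_aut] controls this. *)
Lemma comp_word_inj j k x : XX x -> size j = size k -> cw j x = cw k x -> j = k.
Proof.
move=> XXx; elim: j k => [|c j ih] [|d k]//= [jk] e.
have e' : cw j x = cw k x by rewrite -[LHS](sigmaK c) e sigmaK.
rewrite (ih _ jk e'); congr cons; apply: (XX_disj I I).
exists (gamma c (cw j x)); split; [exists (cw j x)|exists (cw k x)] => //.
  exact: comp_word_in.
exact: comp_word_in.
Qed.

Definition in_image x := exists c y, x = gamma c y.

Lemma in_image_cw k x : k != [::] -> in_image (cw k x).
Proof. by case: k => // c k _; exists c, (cw k x). Qed.

(** An operator that strips at most M letters acts on [cw k x] in a way visible from [k] and [x]: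
    either [k] has M letters, or [x] has no preimage and nothing beyond [k] can be stripped. *)
Definition deep (M : nat) k x := (M <= size k)%N \/ ~ in_image x.

Lemma deep_le M M' k x : (M <= M')%N -> deep M' k x -> deep M k x.
Proof. by move=> MM' [Mk|]; [left; exact: leq_trans Mk|right]. Qed.

Lemma deep_decomp M y : XX y -> exists k x, [/\ XX x, y = cw k x,
  (size k <= M)%N & size k = M \/ ~ in_image x].
Proof.
move=> XXy; elim: M => [|M [k [x [XXx yk kM H]]]].
  by exists [::], y; split=> //; left.
have [[c [x' xx']]|nx] := pselect (in_image x); last first.
  by exists k, x; split=> //; [exact: leqW|right].
case: H => [kM'|]; last by case; exists c, x'.
(* The new letter is applied first, hence stands at the right end of the word. *)
exists (rcons k c), x'; rewrite size_rcons kM'; split=> //; last by left.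
  by apply: (XX_inv c).2; rewrite /preimage/= -xx'.
by rewrite foldr_rcons -xx'.
Qed.

Lemma deep_exists M y : XX y -> exists k x, [/\ XX x, y = cw k x & deep M k x].
Proof.
move=> /(deep_decomp M)[k [x [XXx yk _ H]]]; exists k, x; split=> //.
by case: H => [<-|?]; [left|right].
Qed.

(* Automorphisms of the rooted tree of words that do not move the points
   reached from x. *)
Definition tree_aut x (tau : word -> word) :=
  [/\ injective tau, forall w, size (tau w) = size w,
      forall m w, drop m (tau w) = tau (drop m w)
    & forall w, cw (tau w) x = cw w x].

(** In the tree, the parent of a word is obtained by dropping its first letter. The map exchanges
    the subtrees at [a :: v] and [b :: v] and fixes all other vertices. *)
Fixpoint swap_letters (v : word) (a b : 'I_N) (w : word) : word :=
  if w is c :: w' then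
    (if w' == v then tperm a b c else c) :: swap_letters v a b w'
  else [::].

Lemma swap_tree_aut x v a b : gamma a (cw v x) = gamma b (cw v x) ->
  tree_aut x (swap_letters v a b).
Proof.
move=> ab; split.
- elim=> [|c w ih] [|d w']//= [cd /ih ww']; move: cd; rewrite ww'.
  by case: ifP => _ cd; congr cons => //; exact: perm_inj cd.
- by elim=> //= c w ->.
- by move=> m w; elim: w m => [[]//|c w ih [|m]]//=; rewrite ih.
- elim=> //= c w ->; case: ifP => // /eqP ->.
  by case: tpermP => // ->.
Qed.

Lemma swap_lettersK v a b : swap_letters v a b v = v.
Proof.
suff H w : (size w <= size v)%N -> swap_letters v a b w = w by exact: H.
elim: w => //= c w ih wv; rewrite ih; last exact: ltnW.
by case: eqP => // wv'; rewrite wv' ltnn in wv.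
Qed.

Lemma tree_aut_comp x tau tau' : tree_aut x tau -> tree_aut x tau' ->
  tree_aut x (tau \o tau').
Proof.
move=> [ti ts td tc] [ti' ts' td' tc']; split=> [|w|m w|w] /=.
- exact: inj_comp.
- by rewrite ts ts'.
- by rewrite td td'.
- by rewrite tc tc'.
Qed.

(** Induction along the paths. An automorphism carrying [k] to [k'] carries [c :: k] to some
    [c0 :: k']; the maps of [c0] and [c'] agree at [cw k' x], so the two subtrees may be exchanged.
    Cancelling the first letters by [sigma] makes the induction hypothesis applicable. *)
Lemma tree_aut_exists x k k' : size k = size k' -> cw k x = cw k' x ->
  exists2 tau, tree_aut x tau & tau k = k'.
Proof.
elim: k k' => [|c k ih] [|c' k']//=; first by exists id; split.
move=> [kk'] e; have e' : cw k x = cw k' x by rewrite -[LHS](sigmaK c) e sigmaK.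
have [tau at_ tk] := ih _ kk' e'.
have [c0 tck] : exists c0, tau (c :: k) = c0 :: k'.
  have [_ ts td _] := at_; have := ts (c :: k); have := td 1%N (c :: k).
  by case: (tau (c :: k)) => // c0 k0 /=; rewrite !drop0 tk => -> _; exists c0.
have ec : gamma c0 (cw k' x) = gamma c' (cw k' x).
  by have [_ _ _ /(_ (c :: k))] := at_; rewrite tck/= e.
exists (swap_letters k' c0 c' \o tau).
  by apply: tree_aut_comp => //; exact: swap_tree_aut.
by rewrite /= tck/= eqxx tpermL swap_lettersK.
Qed.

(** The words that a kernel of degree at most D can reach from a word of length n: the finite index
    set of the sum in a product. *)
Definition words_near (n D : nat) : seq word :=
  flatten [seq map val (enum {: p.-tuple 'I_N}) | p <- iota 0 (n + D).+1 & (n <= p + D)%N].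

Lemma mem_words_near n D w :
  (w \in words_near n D) = (n <= size w + D)%N && (size w <= n + D)%N.
Proof.
apply/flattenP/andP => [[s /mapP[p]]|[nw wn]].
  rewrite mem_filter mem_iota add0n ltnS => /and3P[np _ pn] ->.
  by move=> /mapP[t _ ->]; rewrite size_tuple.
exists (map val (enum {: (size w).-tuple 'I_N})).
  by apply/mapP; exists (size w) => //; rewrite mem_filter nw mem_iota add0n ltnS.
by apply/mapP; exists (in_tuple w) => //; rewrite mem_enum.
Qed.

Lemma uniq_words_near n D : uniq (words_near n D).
Proof.
rewrite /words_near.
have := filter_uniq (fun p => n <= p + D)%N (iota_uniq 0 (n + D).+1).
elim: [seq _ <- _ | _] => //= p s ih /andP[ps us]; rewrite cat_uniq ih// andbT.
rewrite map_inj_uniq ?enum_uniq//=; last exact: val_inj.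
apply/hasPn => w /flattenP[_ /mapP[q qs ->] /mapP[t _ ->]].
apply/negP => /mapP[t' _] /(congr1 size); rewrite !size_tuple => qp.
by move: ps; rewrite -qp qs.
Qed.

Lemma perm_words_near x tau n D : tree_aut x tau ->
  perm_eq (map tau (words_near n D)) (words_near n D).
Proof.
move=> [ti ts _ _]; have u : uniq (map tau (words_near n D)).
  by rewrite map_inj_uniq// uniq_words_near.
have sub : {subset map tau (words_near n D) <= words_near n D}.
  by move=> _ /mapP[w ww ->]; rewrite mem_words_near ts -mem_words_near.
apply: uniq_perm => //; first exact: uniq_words_near.
by apply: (uniq_min_size u sub _).2; rewrite size_map.
Qed.

End words.

(** * Continuous complex functions and extension from a dense set *)

Section complex_continuity.
Variables (R : realType) (X : topologicalType).
Implicit Types (f g : X -> R[i]^o) (h : X -> R^o).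

Lemma continuous_normcP f : continuous f <->
  forall x (e : R), 0 < e -> \forall y \near x, normc (f y - f x) <= e.
Proof.
split=> [cf x e e0|cf x].
  have /cvgrPdist_le/(_ (e%:C)%C) := cf x; rewrite ltcR => /(_ e0).
  apply: filterS => y; rewrite normc_distC; exact: (normcP _ _ _).2.
apply/cvgrPdist_le => e; rewrite ltcE => /andP[/eqP ei /= er].
apply: filterS (cf x _ er) => y; rewrite normc_distC => /normcP.
by move: ei; case: (e) => a b /= ->.
Qed.

Lemma continuous_cplx_add f g : continuous f -> continuous g ->
  continuous (fun x => f x + g x : R[i]^o).
Proof. by move=> cf cg x; apply: cvgD; [exact: cf|exact: cg]. Qed.

Lemma continuous_cplx_mul f g : continuous f -> continuous g ->
  continuous (fun x => f x * g x : R[i]^o).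
Proof. by move=> cf cg x; apply: cvgM; [exact: cf|exact: cg]. Qed.

Lemma continuous_cplx_cst (c : R[i]) : continuous (fun _ : X => c : R[i]^o).
Proof. by move=> x; exact: cvg_cst. Qed.

Lemma continuous_cplx_conj f : continuous f -> continuous (fun x => (f x)^* : R[i]^o).
Proof.
move=> /continuous_normcP cf; apply/continuous_normcP => x e /(cf x).
by apply: filterS => y; rewrite -rmorphB/= normc_conj.
Qed.

Lemma continuous_cplx_sum (I : Type) (r : seq I) (P : pred I) (F : I -> X -> R[i]^o) :
  (forall i, continuous (F i)) ->
  continuous (fun x => \sum_(i <- r | P i) F i x : R[i]^o).
Proof.
move=> cF; elim: r => [|i r ih].
  rewrite (_ : (fun x => _) = (fun=> 0)); first exact: continuous_cplx_cst.
  by apply/funext => x; rewrite big_nil.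
case Pi: (P i); last first.
  rewrite (_ : (fun x => _) = (fun x => \sum_(i <- r | P i) F i x)); first exact: ih.
  by apply/funext => x; rewrite big_cons Pi.
rewrite (_ : (fun x => _) = (fun x => F i x + \sum_(i <- r | P i) F i x)).
  exact: (continuous_cplx_add (cF i) ih).
by apply/funext => x; rewrite big_cons Pi.
Qed.

Lemma continuous_Re_Im (f : X -> R[i]^o) :
  (continuous f) <-> (continuous (fun x => complex.Re (f x) : R^o) /\
  continuous (fun x => complex.Im (f x) : R^o)).
Proof.
have ReB z w : complex.Re z - complex.Re w = complex.Re (z - w : R[i]) by case: z; case: w.
have ImB z w : complex.Im z - complex.Im w = complex.Im (z - w : R[i]) by case: z; case: w.
split=> [/continuous_normcP cf|[cr ci]].
  split=> x; apply/cvgrPdist_le => e /(cf x); apply: filterS => y fe.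
    by rewrite distrC ReB; apply: le_trans fe; exact: ler_norm_Re.
  by rewrite distrC ImB; apply: le_trans fe; exact: ler_norm_Im.
apply/continuous_normcP => x e e0.
have /cvgrPdist_le/(_ _ (divr_gt0 e0 (ltr0Sn _ 1))) H1 := cr x.
have /cvgrPdist_le/(_ _ (divr_gt0 e0 (ltr0Sn _ 1))) H2 := ci x.
near=> y; apply: le_trans (ler_normc_ReIm _) _; rewrite (splitr e) -ReB -ImB lerD// distrC.
  by near: y.
by near: y.
Unshelve. all: by end_near. Qed.

Variable XX : set X.
Hypothesis XX_dense : dense XX.

Lemma dense_approx (P : set X) (x : X) : nbhs x P -> exists2 y, XX y & P y.
Proof.
rewrite nbhsE => -[V [oV Vx] VP]; have [|y [Vy XXy]] := XX_dense _ oV; first by exists x.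
by exists y => //; exact: VP.
Qed.

(* The extension at x is the supremum of b x - e over all continuous b that
   are e-close to h on the dense set. *)
Lemma dense_extension_real h :
  (forall e : R, 0 < e -> exists2 b : X -> R^o, continuous b &
     forall y, XX y -> `|h y - b y| <= e) ->
  exists2 a : X -> R^o, continuous a & forall y, XX y -> h y = a y.
Proof.
move=> hb; pose Q (e : R) (b : X -> R^o) := [/\ 0 < e, continuous b &
  forall y, XX y -> `|h y - b y| <= e].
have Qle e b e' b' x : Q e b -> Q e' b' -> b x - e <= b' x + e'.
  move=> [e0 cb hbe] [e0' cb' hbe']; apply/ler_addgt0Pl => d d0.
  have /cvgrPdist_le/(_ _ (divr_gt0 d0 (ltr0Sn _ 1))) H1 := cb x.
  have /cvgrPdist_le/(_ _ (divr_gt0 d0 (ltr0Sn _ 1))) H2 := cb' x.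
  have [y XXy] := dense_approx (filterI H1 H2).
  have := hbe y XXy; have := hbe' y XXy; rewrite /= !ler_norml.
  move=> /andP[? ?] /andP[? ?] [/andP[? ?] /andP[? ?]]; lra.
pose A x := [set r | exists e b, Q e b /\ r = b x - e].
have ub x e b : Q e b -> ubound (A x) (b x + e).
  by move=> Qb _ [e' [b' [Qb' ->]]]; exact: Qle.
have Qex e : 0 < e -> exists b, Q e b.
  by move=> e0; have [b cb hbe] := hb _ e0; exists b.
have Ane x : A x !=set0.
  by have [b Qb] := Qex 1 ltr01; exists (b x - 1), 1, b.
pose a x := sup (A x).
have ab e b x : Q e b -> `|a x - b x| <= e.
  move=> Qb; rewrite ler_distl; apply/andP; split; last first.
    by apply: ge_sup => //; exact: ub.
  apply: ub_le_sup; last by exists e, b.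
  by exists (b x + e); exact: ub.
exists a => [x|y XXy].
  apply/cvgrPdist_le => e e0; have e3 : 0 < e / 3 by rewrite divr_gt0.
  have [b Qb] := Qex _ e3; have [_ cb _] := Qb.
  have /cvgrPdist_le/(_ _ e3) := cb x; apply: filterS => y.
  have := ab _ _ x Qb; have := ab _ _ y Qb; rewrite !ler_norml.
  move=> /andP[? ?] /andP[? ?] /andP[? ?]; apply/andP; split; lra.
apply/eqP; rewrite -subr_eq0 -normr_le0; apply/ler_addgt0Pl => e e0.
have [b Qb] := Qex _ (divr_gt0 e0 (ltr0Sn _ 1)); have [_ _ /(_ _ XXy)] := Qb.
have := ab _ _ y Qb; rewrite !ler_norml.
move=> /andP[? ?] /andP[? ?]; apply/andP; split; lra.
Qed.

Lemma dense_extension (f : X -> R[i]^o) :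
  (forall e : R, 0 < e -> exists2 b : X -> R[i]^o, continuous b &
     forall y, XX y -> normc (f y - b y) <= e) ->
  exists2 a : X -> R[i]^o, continuous a & forall y, XX y -> f y = a y.
Proof.
have ReB z w : complex.Re z - complex.Re w = complex.Re (z - w : R[i]) by case: z; case: w.
have ImB z w : complex.Im z - complex.Im w = complex.Im (z - w : R[i]) by case: z; case: w.
move=> fb; have [|a ca fa] := @dense_extension_real (fun x => complex.Re (f x)).
  move=> e /fb[b /continuous_Re_Im[cr _] be].
  exists (fun x => complex.Re (b x)) => // y XXy; rewrite ReB.
  by apply: le_trans (be y XXy); exact: ler_norm_Re.
have [|c cc fc] := @dense_extension_real (fun x => complex.Im (f x)).
  move=> e /fb[b /continuous_Re_Im[_ ci] be].
  exists (fun x => complex.Im (b x)) => // y XXy; rewrite ImB.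
  by apply: le_trans (be y XXy); exact: ler_norm_Im.
exists (fun x => (a x +i* c x)%C : R[i]^o) => [|y XXy].
  by apply/continuous_Re_Im.
by rewrite -fa// -fc//; case: (f y).
Qed.

End complex_continuity.

(** * The algebra of kernels described by words *)

Section nice_kernels.
Variables (R : realType) (X : topologicalType) (N : nat).
Variables (gamma : 'I_N -> X -> X) (sigma : X -> X) (XX : set X).
Hypothesis gamma_cont : forall k, continuous (gamma k).
Hypothesis sigmaK : forall k x, sigma (gamma k x) = x.
Hypothesis XX_inv : forall k, gamma k @` XX `<=` XX /\ gamma k @^-1` XX `<=` XX.
Hypothesis XX_disj : trivIset [set: 'I_N] (fun k => gamma k @` XX).
Hypothesis XX_dense : dense XX.
Hypothesis cptX : compact [set: X].
Hypothesis hausX : hausdorff_space X.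
Hypothesis image_open : open [set x | in_image gamma x].
Local Notation word := (seq 'I_N).
Local Notation cw := (fun k x => foldr gamma x k).
Local Notation kernel := (int -> X -> X -> R[i]).
Implicit Types (j k w : word) (x y z : X) (d : int) (t : kernel).

(* [t d z y] is the coefficient of degree d from y to z; only its values at
   points of XX matter. *)
Record nice_with t (M D : nat) (F : word -> word -> X -> R[i]^o) : Prop := NiceWith {
  nice_cont : forall j k, continuous (F j k);
  nice_deg : forall d z y, XX z -> XX y -> t d z y <> 0 -> (`|d| <= D)%N;
  nice_val : forall j k x, XX x -> deep gamma M k x ->
    t ((size j)%:Z - (size k)%:Z) (cw j x) (cw k x) = F j k x;
  nice_supp : forall k x d z, XX x -> XX z -> deep gamma M k x ->
    t d z (cw k x) <> 0 -> exists2 j, (size j)%:Z = (size k)%:Z + d & z = cw j x;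
  nice_aut : forall x tau, tree_aut gamma x tau ->
    forall j k, F (tau j) (tau k) x = F j k x }.

(** M is the depth from which F describes the coefficients, D a bound for the degrees. Products
    raise both, adjoints raise M. *)
Definition nice t := exists M D F, nice_with t M D F.

Lemma nice_withW t M M' D F : (M <= M')%N -> nice_with t M D F -> nice_with t M' D F.
Proof.
move=> MM' [h1 h2 h3 h4 h5]; split=> //.
  by move=> j k x XXx /(deep_le MM')/h3; exact.
by move=> k x d z XXx XXz /(deep_le MM')/h4; exact.
Qed.

Lemma comp_word_cont k : continuous (cw k : X -> X).
Proof.
elim: k => [x|c k ih x] /=; first exact: cvg_id.
apply: (@continuous_comp _ _ _ (cw k) (gamma c)); first exact: ih.
exact: gamma_cont.
Qed.

Lemma nice_lin (c : R[i]) t t' : nice t -> nice t' ->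
  nice (fun d z y => c * t d z y + t' d z y).
Proof.
move=> [M [D [F nt]]] [M' [D' [F' nt']]].
exists (maxn M M'), (maxn D D'), (fun j k x => c * F j k x + F' j k x).
have {nt}[h1 h2 h3 h4 h5] := nice_withW (leq_maxl M M') nt.
have {nt'}[h1' h2' h3' h4' h5'] := nice_withW (leq_maxr M M') nt'.
have nz (a b : R[i]) : c * a + b <> 0 -> a <> 0 \/ b <> 0.
  have [->|/eqP an _] := eqVneq a 0; last by left.
  by rewrite mulr0 add0r; right.
split.
- move=> j k; apply: continuous_cplx_add (h1' _ _).
  by apply: continuous_cplx_mul; [exact: continuous_cplx_cst|exact: h1].
- move=> d z y XXz XXy /nz[/(h2 _ _ _ XXz XXy)|/(h2' _ _ _ XXz XXy)] H.
    by rewrite leq_max H.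
  by rewrite leq_max H orbT.
- by move=> j k x XXx dk; rewrite h3// h3'.
- by move=> k x d z XXx XXz dk /nz[/h4|/h4']; exact.
- by move=> x tau xt j k; rewrite h5// h5'.
Qed.

(** The last hypothesis is the product of matrix coefficients, with the intermediate points listed
    by words; for operators it comes from [nice_column]. *)
Lemma nice_mul tT t MT DT FT tS MS DS FS :
  nice_with tT MT DT FT -> nice_with tS MS DS FS ->
  (forall k x z d, XX x -> XX z -> deep gamma MS k x -> t d z (cw k x) =
     \sum_(j <- words_near N (size k) DS)
        FS j k x * tT (d - ((size j)%:Z - (size k)%:Z)) z (cw j x)) ->
  nice t.
Proof.
move=> [h1 h2 h3 h4 h5] [h1' h2' h3' h4' h5'] tE.
(* The factor applied first may shorten a word by [DS] letters, and the other one then still needs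
   [MT]. *)
pose M := maxn MS (MT + DS); pose D := (DT + DS)%N.
have dS k x : deep gamma M k x -> deep gamma MS k x by apply: deep_le; exact: leq_maxl.
have dT j k x : j \in words_near N (size k) DS -> deep gamma M k x -> deep gamma MT j x.
  rewrite mem_words_near => /andP[kj _] [|]; last by right.
  by rewrite geq_max => /andP[_ Mk]; left; lia.
have tnz k x z d : XX x -> XX z -> deep gamma M k x -> t d z (cw k x) <> 0 ->
    exists2 j : word, j \in words_near N (size k) DS &
      tT (d - ((size j)%:Z - (size k)%:Z)) z (cw j x) <> 0.
  move=> XXx XXz dk; rewrite tE//; last exact: dS.
  move=> s0; apply: contrapT => H; apply: s0; rewrite big1_seq// => j /andP[_ jk].
  apply/eqP; rewrite mulf_eq0; apply/orP; right; apply/eqP.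
  by apply: contrapT => ne; apply: H; exists j.
exists M, D, (fun l k x => \sum_(j <- words_near N (size k) DS) FS j k x * FT l j x).
split.
- move=> j k; apply: continuous_cplx_sum => i.
  by apply: continuous_cplx_mul; [exact: h1'|exact: h1].
- move=> d z y XXz XXy; have [k [x [XXx -> dk]]] := deep_exists XX_inv M XXy.
  move=> /(tnz _ _ _ _ XXx XXz dk)[j jk].
  move=> /(h2 _ _ _ XXz (comp_word_in XX_inv _ XXx)).
  by move: jk; rewrite mem_words_near /D; lia.
- move=> l k x XXx dk; rewrite tE//; [|exact: comp_word_in|exact: dS].
  apply: eq_big_seq => j jk; congr (_ * _).
  rewrite -h3//; last exact: dT dk.
  by congr (tT _ _ _); lia.
- move=> k x d z XXx XXz dk /(tnz _ _ _ _ XXx XXz dk)[j jk].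
  move=> /(h4 _ _ _ _ XXx XXz (dT _ _ _ jk dk))[l lj ->].
  by exists l => //; lia.
(* [tau] preserves lengths and so permutes the intermediate words; reindexing the sum by it moves
   all three words at once. *)
- move=> x tau xt l k; have [_ ts _ _] := xt.
  rewrite ts -(perm_big _ (perm_words_near _ _ xt)) big_map.
  by apply: eq_bigr => j _; rewrite h5// h5'.
Qed.

Lemma nice_adjoint t : nice t -> nice (fun d z y => (t (- d) y z)^*).
Proof.
move=> [M [D [F [h1 h2 h3 h4 h5]]]].
pose near j k := ((size k <= size j + D) && (size j <= size k + D))%N.
(* Nonzero entries need lengths that differ by at most D. If [k] has M + D letters, such a [j] has
   at least M, so the formula for [t] applies with the words exchanged. *)
exists (M + D)%N, D, (fun j k x => if near j k then (F k j x)^* else 0).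
have cn (a : R[i]) : a^* <> 0 -> a <> 0 by move=> + a0; rewrite a0 conjC0.
split.
- move=> j k; case: (near j k); last exact: continuous_cplx_cst.
  exact: continuous_cplx_conj.
- by move=> d z y XXz XXy /cn/(h2 _ _ _ XXy XXz); rewrite abszN.
- move=> j k x XXx dk; rewrite opprB; case: ifP => [/andP[kj _]|njk].
    rewrite h3//; case: dk => [Mk|]; [left|by right].
    by lia.
  have [->|/eqP/h2 H] := eqVneq (t ((size k)%:Z - (size j)%:Z) (cw k x) (cw j x)) 0.
    exact: conjC0.
  have {}H := H (comp_word_in XX_inv _ XXx) (comp_word_in XX_inv _ XXx).
  by exfalso; move: njk; rewrite /near; lia.
- move=> k x d z XXx XXz dk /cn tn.
  have dD := h2 _ _ _ (comp_word_in XX_inv _ XXx) XXz tn.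
  (* The support of [t] is known from its source, which is now [z = cw l u]; this gives
     [cw k x = cw j u]. If [j] is not longer than [k], then [u], and with it [z], is reached from
     [x]. A longer [j] is excluded: it has at most M + D letters, and its surplus letters would give
     a preimage of [x]. *)
  have [l [u [XXu zl lM lu]]] := deep_decomp XX_inv M XXz.
  have dl : deep gamma M l u by case: lu => [<-|?]; [left|right].
  move: tn; rewrite zl => /(h4 _ _ _ _ XXu (comp_word_in XX_inv _ XXx) dl)[j jl xj].
  have [jk|kj] := leqP (size j) (size k).
    exists (l ++ drop (size j) k).
      by rewrite size_cat size_drop; lia.
    rewrite comp_word_cat; congr (foldr gamma _ l).
    move: xj; rewrite -{1}(cat_take_drop (size j) k) comp_word_cat => /esym.
    by apply: (comp_word_sizeI sigmaK); rewrite size_takel.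
  case: dk => [kM|[]]; first by exfalso; lia.
  have -> : x = cw (drop (size k) j) u.
    move: xj; rewrite -{1}(cat_take_drop (size k) j) comp_word_cat.
    by apply: (comp_word_sizeI sigmaK); rewrite size_takel// ltnW.
  by apply: in_image_cw; rewrite -size_eq0 size_drop subn_eq0 -ltnNge.
- move=> x tau xt j k; have [_ ts _ _] := xt.
  by rewrite /near !ts h5.
Qed.

(* G j k stands for a function on pairs of chains of lengths m and n starting
   at the same point. *)
Lemma nice_symbol (m n : nat) t (G : word -> word -> X -> R[i]^o) :
  (forall j k, size j = m -> size k = n -> continuous (G j k)) ->
  (forall j j' k k' x, size j = m -> size j' = m -> size k = n -> size k' = n ->
     cw j x = cw j' x -> cw k x = cw k' x -> G j k x = G j' k' x) ->
  (forall j k x, XX x -> size j = m -> size k = n ->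
     t (m%:Z - n%:Z) (cw j x) (cw k x) = G j k x) ->
  (forall d z y, XX z -> XX y -> t d z y <> 0 -> d = m%:Z - n%:Z /\
     exists j k x, [/\ XX x, size j = m, size k = n, z = cw j x & y = cw k x]) ->
  nice t.
Proof.
move=> Gc Gw tG tnz.
(* The operator puts m letters in the place of n letters, so words with a nonzero coefficient have a
   common tail. Tails are compared as words and not by their values at x, so the case distinction
   does not depend on x and F stays continuous. *)
pose ok j k := [&& n <= size k, size j + n == size k + m & drop m j == drop n k]%N.
exists n, (m + n)%N, (fun j k x => if ok j k then
   G (take m j) (take n k) (cw (drop n k) x) else 0).
have okS j k : ok j k -> [/\ (m <= size j)%N, size (take m j) = m & size (take n k) = n].
  move=> /and3P[nk /eqP jk _]; have mj : (m <= size j)%N by lia.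
  by rewrite !size_takel.
split.
- move=> j k; have := okS j k; case: (ok j k) => [/(_ isT)[_ mj nk]|_]; last exact: continuous_cplx_cst.
  move=> x; apply: (@continuous_comp _ _ _ (cw (drop n k)) (G (take m j) (take n k))).
    exact: comp_word_cont.
  exact: Gc.
- by move=> d z y XXz XXy /(tnz _ _ _ XXz XXy)[-> _]; lia.
- move=> j k x XXx dk; case: ifP => [okjk|nok].
    have [mj sj sk] := okS _ _ okjk; have /and3P[nk /eqP jk /eqP djk] := okjk.
    rewrite -tG//; last exact: comp_word_in.
    rewrite -{1}djk -!comp_word_cat !cat_take_drop.
    by congr (t _ _ _); lia.
  apply: contrapT => /(tnz _ _ _ (comp_word_in XX_inv _ XXx) (comp_word_in XX_inv _ XXx)).
  move=> [djk [j' [k' [x' [XXx' sj' sk' jj' kk']]]]].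
  have [nk|kn] := leqP n (size k); last first.
    case: dk => [|[]]; first by rewrite leqNgt kn.
    have -> : x = cw (drop (size k) k') x'.
      move: kk'; rewrite -{1}(cat_take_drop (size k) k') comp_word_cat.
      by apply: (comp_word_sizeI sigmaK); rewrite size_takel// sk' ltnW.
    by apply: in_image_cw; rewrite -size_eq0 size_drop subn_eq0 -ltnNge sk'.
  have mj : (m <= size j)%N by lia.
  have xx' : x' = cw (drop n k) x.
    move: kk'; rewrite -{1}(cat_take_drop n k) comp_word_cat => /esym.
    by apply: (comp_word_sizeI sigmaK); rewrite size_takel.
  have e : j = j' ++ drop n k.
    apply: (comp_word_inj sigmaK XX_inv XX_disj XXx).
      by rewrite size_cat size_drop; lia.
    by rewrite comp_word_cat -xx'.
  move/negP: nok; apply; apply/and3P; split=> //.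
    by apply/eqP; lia.
  by rewrite e drop_size_cat.
- move=> k x d z XXx XXz dk /(tnz _ _ _ XXz (comp_word_in XX_inv _ XXx)).
  move=> [dmn [j' [k' [x' [XXx' sj' sk' zj' kk']]]]].
  have [nk|kn] := leqP n (size k); last first.
    exfalso; case: dk => [|[]]; first by rewrite leqNgt kn.
    have -> : x = cw (drop (size k) k') x'.
      move: kk'; rewrite -{1}(cat_take_drop (size k) k') comp_word_cat.
      by apply: (comp_word_sizeI sigmaK); rewrite size_takel// sk' ltnW.
    by apply: in_image_cw; rewrite -size_eq0 size_drop subn_eq0 -ltnNge sk'.
  have xx' : x' = cw (drop n k) x.
    move: kk'; rewrite -{1}(cat_take_drop n k) comp_word_cat => /esym.
    by apply: (comp_word_sizeI sigmaK); rewrite size_takel.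
  exists (j' ++ drop n k); first by rewrite size_cat size_drop; lia.
  by rewrite comp_word_cat -xx'.
- move=> x tau xt j k; have [ti ts td tc] := xt.
  have -> : ok (tau j) (tau k) = ok j k.
    by rewrite /ok !ts !td (inj_eq ti).
  case: ifP => // okjk; have [mj sj sk] := okS _ _ okjk.
  have /and3P[nk /eqP jk /eqP djk] := okjk.
  rewrite td tc; apply: Gw => //; rewrite ?size_takel ?ts//.
    rewrite -djk -[in LHS](tc (drop m j)) -td -!comp_word_cat !cat_take_drop.
    exact: tc.
  by rewrite -[in LHS](tc (drop n k)) -td -!comp_word_cat !cat_take_drop tc.
Qed.

(** Every y in X, not only in [XX], is [cw k x] with [k] of length M, or shorter and [x] without a
    preimage. The length of [k], and with it [x], is determined by y, and [k] is determined up to an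
    automorphism; so [F k k x] is a function of y. *)
Lemma nice_diagonal t : nice t ->
  exists2 a : X -> R[i]^o, continuous a & forall y, XX y -> t 0 y y = a y.
Proof.
move=> [M [D [F [h1 h2 h3 h4 h5]]]].
pose P y (p : word * X) := [/\ y = cw p.1 p.2, (size p.1 <= M)%N &
  size p.1 = M \/ ~ in_image gamma p.2].
have exP y : exists p, P y p.
  (* [deep_decomp] is applied with [setT] in the place of [XX], to decompose every point of the
     space. *)
  have inv c : gamma c @` setT `<=` setT /\ gamma c @^-1` setT `<=` setT by [].
  have [k [x [_ -> kM H]]] := @deep_decomp X N gamma setT inv M y I.
  by exists (k, x).
have [sel selP] := choice exP.
pose a y : R[i]^o := F (sel y).1 (sel y).1 (sel y).2.
have le y p q : P y p -> P y q -> (size q.1 <= size p.1)%N.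
  move: p q => [k x] [l u] [/= yk kM H] [/= yl lM _]; rewrite leqNgt; apply/negP => kl.
  case: H => [kM'|[]]; first by lia.
  have -> : x = cw (drop (size k) l) u.
    move: yl; rewrite yk -{1}(cat_take_drop (size k) l) comp_word_cat.
    by apply: (comp_word_sizeI sigmaK); rewrite size_takel// ltnW.
  by apply: in_image_cw; rewrite -size_eq0 size_drop subn_eq0 -ltnNge.
have aE y p : P y p -> a y = F p.1 p.1 p.2.
  move=> Pyp; have Pys := selP y; have := le _ _ _ Pyp Pys; have := le _ _ _ Pys Pyp.
  move: Pyp Pys; rewrite /a; move: (sel y) p => [k x] [l u] [/= yl _ _] [/= yk _ _] lk kl.
  have skl : size k = size l by apply/eqP; rewrite eqn_leq kl lk.
  have xu : x = u by apply: (comp_word_sizeI sigmaK skl); rewrite -yk.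
  rewrite -{u}xu in yl *; have ekl : cw k x = cw l x by rewrite -yl -yk.
  by have [tau xt <-] := tree_aut_exists sigmaK skl ekl; rewrite h5.
exists a => [|y XXy]; last first.
  have [k [x [XXx yk kM H]]] := deep_decomp XX_inv M XXy.
  rewrite (aE y (k, x))// -h3//=; last by case: H => [<-|?]; [left|right].
  by rewrite -yk subrr.
apply/continuous_closedP => A cA.
(* There are finitely many words of length at most M. For each, the admissible base points with
   value in A form a closed, hence compact set, whose image under the word is again compact. *)
have -> : a @^-1` A = \bigcup_(p in [set: {p : 'I_M.+1 & p.-tuple 'I_N}])
    [set cw (tagged p) x | x in F (tagged p) (tagged p) @^-1` A `&`
       [set x | val (tag p) = M \/ ~ in_image gamma x]].
  apply/seteqP; split=> [y /= ay|y [[p k] _ [x [/= Ax H] <-]]].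
    have [yk kM H] := selP y; move: (aE y _ (selP y)) yk kM H.
    case: (sel y) => k x /= ak yk kM H.
    exists (existT (fun p : 'I_M.+1 => p.-tuple 'I_N) (Ordinal (kM : (size k < M.+1)%N)) (in_tuple k)) => //=.
    by exists x => //; split=> //; rewrite /preimage/= -ak.
  rewrite /preimage/= (aE _ (val k, x))//; split=> //=.
    by rewrite size_tuple -ltnS.
  by rewrite size_tuple.
apply: closed_bigcup => [|[p k] _ /=]; first exact: finite_finset.
apply: compact_closed => //; apply: continuous_compact.
  by apply: continuous_subspaceT => x; exact: comp_word_cont.
apply: subclosed_compact cptX _ => //; apply: closedI.
  by move: A cA; apply/continuous_closedP; exact: h1.
have [->|pM] := pselect (val p = M).
  rewrite (_ : [set x | _] = setT); first exact: closedT.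
  by apply/seteqP; split=> // x _; left.
rewrite (_ : [set x | _] = ~` [set x | in_image gamma x]); first exact: open_closedC.
by apply/seteqP; split=> [x [//|//]|x nx]; right.
Qed.

Hypothesis image_closed : closed [set x | in_image gamma x].
Hypothesis gamma_free : forall k l : word, k <> l ->
  (closure [set x | cw k x = cw l x])° = set0.

Lemma nice_diagonal_limit (t0 : kernel) :
  (forall d z y, XX z -> XX y -> z <> y -> t0 d z y = 0) ->
  (forall e : R, 0 < e -> exists2 t, nice t &
     forall d z y, XX z -> XX y -> normc (t0 d z y - t d z y) <= e) ->
  exists2 a : X -> R[i]^o, continuous a &
    forall d y, XX y -> t0 d y y = if d == 0 then a y else 0.
Proof.
move=> t0d t0n; have [a ca ta] : exists2 a : X -> R[i]^o, continuous a &
    forall y, XX y -> t0 0 y y = a y.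
  apply: dense_extension => // e /t0n[t /nice_diagonal[b cb tb] te].
  by exists b => // y XXy; rewrite -tb// te.
exists a => // d y XXy; case: eqP => [->|d0]; first exact: ta.
apply: normc_eq0_le => e e0; have e3 : 0 < e / 3 by rewrite divr_gt0.
have [t nt te] := t0n _ e3; have [M [D [F [h1 h2 h3 h4 h5]]]] := nt.
have [k [x [XXx yk dk]]] := deep_exists XX_inv M XXy.
have tdiag : normc (t d y y) <= e / 3 + e / 3.
  have [->|/eqP tn] := eqVneq (t d y y) 0.
    by rewrite Normc.normc0; apply/addr_ge0; exact: ltW.
  have := tn; rewrite {2}yk => /(h4 _ _ _ _ XXx XXy dk)[j jk yj].
  have djk : d = (size j)%:Z - (size k)%:Z by lia.
  have njk : j <> k by move=> jk'; apply: d0; rewrite djk jk' subrr.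
  have -> : t d y y = F j k x by rewrite {1}yj yk djk h3.
  (* If [k] is long, depth holds at every base point; otherwise it holds near [x] because the
     complement of gamma(X) is open. *)
  have nearF : nbhs x [set x' | normc (F j k x' - F j k x) <= e / 3 /\ deep gamma M k x'].
    have /continuous_normcP/(_ x _ e3) H := h1 j k.
    case: dk => [Mk|nx]; first by apply: filterS H => x' ?; split => //; left.
    have : nbhs x (~` [set x | in_image gamma x]).
      by apply: open_nbhs_nbhs; split => //; exact: closed_openC.
    by move=> H'; apply: filterS (filterI H H') => x' [? ?]; split => //; right.
  move: nearF; rewrite nbhsE => -[V [oV Vx] VP].
  (* The closure of the coincidence set has no interior point, so it does not contain V; the rest of
     V is open and nonempty and meets [XX]. *)
  have [|x' [[Vx' nx'] XXx']] := XX_dense _ (openI oV (closed_openC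
      (@closed_closure _ [set x | cw j x = cw k x]))).
    apply: contrapT => H; have : (closure [set x | cw j x = cw k x])° x.
      rewrite /interior/= nbhsE; exists V; [by split|move=> u Vu; apply: contrapT => nu].
      by apply: H; exists u.
    by rewrite gamma_free.
  have [Fx' dx'] := VP _ Vx'.
  rewrite -[F j k x](subKr (F j k x')); apply: le_trans (ler_normcD _ _) _.
  rewrite normc_opp lerD// -h3//.
  have := te ((size j)%:Z - (size k)%:Z) _ _ (comp_word_in XX_inv j XXx')
    (comp_word_in XX_inv k XXx').
  rewrite t0d ?sub0r ?normc_opp//; try exact: comp_word_in.
  by move=> jkx'; apply: nx'; apply: subset_closure.
rewrite -[t0 d y y](subrK (t d y y)); apply: le_trans (ler_normcD _ _) _.
(* One third for replacing [t0] by [t], one for moving from [x] to [x'], one for the coefficient of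
   [t] at [x'], where [t0] vanishes. *)
have -> : e = e / 3 + (e / 3 + e / 3) by field.
by rewrite lerD// te.
Qed.

End nice_kernels.

(** * Bounds, pullbacks and basis vectors *)

Lemma compact_bounded_normc (R : realType) (X : topologicalType) (f : X -> R[i]^o) :
  compact [set: X] -> continuous f -> exists M : R, forall x, normc (f x) <= M.
Proof.
move=> cptX /continuous_Re_Im[cr ci].
have bnd (h : X -> R^o) : continuous h -> exists M : R, forall x, `|h x| <= M.
  move=> ch; have : compact (h @` [set: X]).
    by apply: continuous_compact => //; exact: continuous_subspaceT.
  move=> /compact_bounded/pinfty_ex_gt0[M _ hM]; exists M => x.
  by apply: hM; exists x.
have [M1 H1] := bnd _ cr; have [M2 H2] := bnd _ ci.
exists (M1 + M2) => x; apply: le_trans (ler_normc_ReIm _) _.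
by apply: lerD; [exact: H1|exact: H2].
Qed.

(** Elements of C(K) are represented by total functions continuous on K only. Composed with a
    continuous map into K they become continuous everywhere, as [nice_symbol] requires. *)
Lemma pull_within_continuous (X Y Z : topologicalType) (A : set Y) (f : Y -> Z)
    (h : X -> Y) : {within A, continuous f} -> continuous h ->
  (forall x, A (h x)) -> continuous (f \o h).
Proof.
move=> /subspace_continuousP cf ch Ah x.
apply: (@cvg_comp _ _ _ h f (nbhs x) (within A (nbhs (h x)))); last exact: cf.
move=> B /ch nB; suff : nbhs x (h @^-1` B) by [].
by apply: (@filterS X (nbhs x) _ _ (h @^-1` B) _ nB) => y Hy; exact: (Hy (Ah y)).
Qed.

Lemma row_continuous (X Y : topologicalType) (n : nat) (h : 'I_n -> X -> Y) :
  (forall i, continuous (h i)) -> continuous (fun x => \row_i h i x : 'rV[Y]_n).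
Proof.
move=> ch x B [P PM PB].
have : \forall y \near x, forall i, P ord0 i (h i y).
  by apply: filter_forall => i; apply: ch; have := PM ord0 i; rewrite mxE.
by apply: filterS => y Py; apply: PB => i j; rewrite mxE (ord1 i).
Qed.

Lemma l2norm_basis_le1 (R : realType) (S : choiceType) (s : S) :
  l2norm (l2_basis R s) <= 1.
Proof.
have := @l2norm_sum_basis R S (fun=> 1) [:: s] 1 isT ler01.
by rewrite !big_seq1 scale1r Normc.normc1 expr1n; apply.
Qed.

Lemma l2_basis_pair (R : realType) (S T : choiceType) (s : S) (t : T) :
  l2_basis R (s, t) = tensv (l2_basis R s) (l2_basis R t).
Proof.
apply: l2_ext => -[a b]; rewrite -[RHS]/(l2_basis R s a * l2_basis R t b).
by rewrite !l2_basisE xpair_eqE -natrM mulnb.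
Qed.

(** * Multiplication operators on the tensor product with l2(Z) *)

Section hat_space.
Variables (R : realType) (X : topologicalType) (XX : set X).
Local Notation H := (l2 R XX).
Local Notation Hhat := (l2 R (XX * int)%type).
Local Notation hatA := (hat_rhoA_range R XX).
Hypothesis cptX : compact [set: X].
Hypothesis XX_dense : dense XX.

Lemma XX_lift (x : X) : XX x -> exists x' : XX, val x' = x.
Proof. by move=> XXx; exists (SigSub (mem_set XXx)). Qed.

Lemma valXX (x : XX) : XX (val x).
Proof. exact: set_valP. Qed.

Lemma l2_basis_at_val (x : XX) : @l2_basis_at R X XX (val x) = l2_basis R x.
Proof. by rewrite /l2_basis_at valK. Qed.

Lemma op_closure_coef (S : choiceType) (B : set (l2 R S -> l2 R S)) T (e : R) :
  op_closure B T -> 0 < e -> exists2 T', B T' &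
    forall p q, normc (T (l2_basis R q) p - T' (l2_basis R q) p) <= e.
Proof.
move=> /op_closureP[_ BT] e0; have [T' BT' TT'] := BT _ e0; exists T' => // p q.
rewrite -l2_subE; apply: le_trans (l2_coord_le _ _) _.
apply: le_trans (TT' _) _; apply: (@le_trans _ _ (e * 1)); last by rewrite mulr1.
by rewrite ler_wpM2l ?l2norm_basis_le1// ltW.
Qed.

Lemma tensor_coef T0 (k : int) T (y z : XX) (i l : int) :
  is_tensor T0 (@l2_shift R k) T ->
  T (l2_basis R (y, i)) (z, l) = T0 (l2_basis R y) z * (l - k == i)%:R.
Proof. by move=> [_ TT]; rewrite l2_basis_pair TT. Qed.

(** In coordinates, rho_A(a) tensored with the identity of l2(Z). *)
Definition hat_mul (a : X -> R[i]^o) (T : Hhat -> Hhat) :=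
  forall u p, T u p = a (val p.1) * u p.

Lemma hat_mul_exists (a : X -> R[i]^o) : continuous a ->
  exists2 T : Hhat -> Hhat, bounded_op T & hat_mul a T.
Proof.
move=> ca; have [M aM] := compact_bounded_normc cptX ca.
by have [T bT TE] := @mul_op_exists R (XX * int)%type (fun p => a (val p.1)) M (fun p => aM _); exists T.
Qed.

Lemma hat_mul_basis (a : X -> R[i]^o) T : continuous a -> bounded_op T ->
  (forall p q, T (l2_basis R q) p = if p == q then a (val q.1) else 0) -> hat_mul a T.
Proof.
move=> ca bT TE; have [T' bT' T'E] := hat_mul_exists ca.
suff -> : T = T' by [].
apply: bounded_op_ext => // q; apply: l2_ext => p.
by rewrite TE T'E l2_basisE; case: eqP => [->|_]; rewrite ?mulr1 ?mulr0.
Qed.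

Lemma hat_rhoA_rangeP T : hatA T <->
  bounded_op T /\ exists2 a : X -> R[i]^o, continuous a & hat_mul a T.
Proof.
split=> [[a [T0 [ca [_ T0E] TT]]]|[bT [a ca TE]]].
  have [bT _] := TT; split=> //; exists a => //; apply: hat_mul_basis => // -[z l] [y i].
  rewrite (tensor_coef _ _ _ _ TT) subr0 T0E l2_scaleE l2_basisE -mulrA -natrM mulnb -xpair_eqE.
  by case: eqP => [_|_]; rewrite ?mulr1 ?mulr0.
have [M aM] := compact_bounded_normc cptX ca.
have [T0 bT0 T0E] := @mul_op_exists R XX (fun p => a (val p)) M (fun p => aM _).
exists a, T0; split=> //; split=> //.
  move=> x; apply: l2_ext => y; rewrite T0E l2_scaleE l2_basisE.
  by case: eqP => [->|]; rewrite ?mulr0.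
move=> u v; apply: l2_ext => -[x i].
by rewrite TE -[LHS]/(a (val x) * (u x * v i)) -[RHS]/(T0 u x * v (i - 0)) subr0 T0E mulrA.
Qed.

Lemma hat_mul_coef (a : X -> R[i]^o) T p q : hat_mul a T ->
  T (l2_basis R q) p = if p == q then a (val q.1) else 0.
Proof. by move=> ->; rewrite l2_basisE; case: eqP => [->|_]; rewrite ?mulr1 ?mulr0. Qed.

Lemma hat_rhoA_star : commutative_star_subalgebra hatA.
Proof.
split; last first.
  move=> T T' /hat_rhoA_rangeP[_ [a _ TE]] /hat_rhoA_rangeP[_ [b _ T'E]].
  by apply/funext => u; apply: l2_ext => p; rewrite /= TE T'E T'E TE mulrCA.
split.
- by move=> T /hat_rhoA_rangeP[].
- split.
    apply/hat_rhoA_rangeP; split; first exact: bounded_op0.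
    exists (fun=> 0) => [|u p]; first exact: continuous_cplx_cst.
    by rewrite mul0r.
  move=> c T T' /hat_rhoA_rangeP[bT [a ca TE]] /hat_rhoA_rangeP[bT' [b cb T'E]].
  apply/hat_rhoA_rangeP; split; first exact: bounded_op_comb.
  exists (fun x => c * a x + b x) => [|u p].
    apply: continuous_cplx_add cb.
    by apply: continuous_cplx_mul ca; exact: continuous_cplx_cst.
  by rewrite -[LHS]/(c * T u p + T' u p) TE T'E mulrDl mulrA.
- move=> T T' /hat_rhoA_rangeP[bT [a ca TE]] /hat_rhoA_rangeP[bT' [b cb T'E]].
  apply/hat_rhoA_rangeP; split; first exact: bounded_op_comp.
  exists (fun x => a x * b x) => [|u p]; first exact: continuous_cplx_mul.
  by rewrite /= TE T'E mulrA.
- move=> T T' /hat_rhoA_rangeP[bT [a ca TE]] bT' TT'.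
  have ca' := continuous_cplx_conj ca.
  apply/hat_rhoA_rangeP; split; [exact: bT'|exists (fun x => (a x)^*); first exact: ca'].
  apply: (hat_mul_basis ca' bT') => p q.
  rewrite (adjoint_coef _ _ TT') (hat_mul_coef _ _ TE) eq_sym.
  by case: eqP => [->//|_]; rewrite conjC0.
Qed.

Lemma hat_rhoA_closed : op_closure hatA `<=` hatA.
Proof.
move=> T cT; have [bT _] := cT; apply/hat_rhoA_rangeP; split=> //.
(* The symbol is read off at level 0 of Z, with a dummy value off [XX]. Other levels are compared
   with it through approximants, whose symbol is the same on all levels. *)
pose f (x : X) : R[i]^o := if insub x is Some x' then T (l2_basis R (x' : XX, 0)) (x', 0) else 0.
have fE (x : XX) : f (val x) = T (l2_basis R (x, 0)) (x, 0) by rewrite /f valK.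
have approx (e : R) : 0 < e -> exists2 b : X -> R[i]^o, continuous b & forall p q,
    normc (T (l2_basis R q) p - if p == q then b (val q.1) else 0) <= e.
  move=> e0; have [T' /hat_rhoA_rangeP[_ [b cb T'E]] TT'] := op_closure_coef cT e0.
  by exists b => // p q; rewrite -(hat_mul_coef _ _ T'E).
have [a ca fa] : exists2 a : X -> R[i]^o, continuous a & forall y, XX y -> f y = a y.
  apply: dense_extension => // e /approx[b cb bT']; exists b => // y XXy.
  have [y' <-] := XX_lift XXy; rewrite fE.
  by have := bT' (y', 0) (y', 0); rewrite eqxx.
exists a => //; apply: hat_mul_basis => // p q; apply/eqP; rewrite -subr_eq0; apply/eqP.
apply: normc_eq0_le => e e0; case: eqP => [->|/eqP/negPf pq].
  case: q => x i /=; have [b cb bT'] := approx _ (divr_gt0 e0 (ltr0Sn _ 1)).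
  rewrite -fa; last exact: valXX.
  have := bT' (x, i) (x, i); have := bT' (x, 0) (x, 0); rewrite !eqxx fE/=.
  move: (T _ (x, 0)) (T _ (x, i)) (b _) => r s t rt st.
  have -> : s - r = (s - t) - (r - t) by ring.
  by rewrite (splitr e); apply: le_trans (ler_normcD _ _) _; rewrite normc_opp lerD.
by have [b cb bT'] := approx _ e0; have := bT' p q; rewrite pq.
Qed.

End hat_space.

(** * Operators with nice kernels *)

Section nice_operators.
Variables (R : realType) (X : topologicalType) (N : nat).
Variables (gamma : 'I_N -> X -> X) (sigma : X -> X) (XX : set X).
Hypothesis gamma_cont : forall k, continuous (gamma k).
Hypothesis sigmaK : forall k x, sigma (gamma k x) = x.
Hypothesis XX_inv : completely_invariant gamma XX.
Hypothesis XX_disj : trivIset [set: 'I_N] (fun k => gamma k @` XX).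
Local Notation word := (seq 'I_N).
Local Notation cw := (fun k x => foldr gamma x k).
Local Notation H := (l2 R XX).
Local Notation Hhat := (l2 R (XX * int)%type).
Local Notation ebat := (@l2_basis_at R X XX).
Implicit Types (j k w : word).

Definition l2_at (u : H) (z : X) : R[i] := oapp u 0 (insub z).

Lemma l2_at_val u (z : XX) : l2_at u (val z) = u z.
Proof. by rewrite /l2_at valK. Qed.

Lemma l2_at_basis (z x : X) : XX z -> XX x -> l2_at (ebat x) z = (z == x)%:R.
Proof.
move=> /XX_lift[z' <-] /XX_lift[x' <-].
by rewrite l2_at_val l2_basis_at_val l2_basisE (inj_eq val_inj).
Qed.

Lemma l2_at_sum (I : Type) (r : seq I) (c : I -> R[i]) (F : I -> H) (z : X) : XX z ->
  l2_at (\sum_(i <- r) c i *: F i) z = \sum_(i <- r) c i * l2_at (F i) z.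
Proof.
move=> /XX_lift[z' <-]; rewrite l2_at_val l2_sumE; apply: eq_bigr => i _.
by rewrite l2_scaleE l2_at_val.
Qed.

(* the kernel of T0 (x) v_k *)
Definition op_kernel (c : int) (T0 : H -> H) (d : int) (z y : X) : R[i] :=
  if d == c then l2_at (T0 (ebat y)) z else 0.

Lemma op_kernel_val c T0 d (z y : XX) : op_kernel c T0 d (val z) (val y) =
  if d == c then T0 (l2_basis R y) z else 0.
Proof. by rewrite /op_kernel l2_basis_at_val l2_at_val. Qed.

(** Coefficients depend on the levels only through [l - i], as every generator is a tensor product
    with a power of the shift; this difference is the degree. *)
Definition hat_nice (T : Hhat -> Hhat) := bounded_op T /\
  exists2 t, nice gamma XX t & forall (y z : XX) i l,
    T (l2_basis R (y, i)) (z, l) = t (l - i) (val z) (val y).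

Lemma hat_nice_tensor T0 (c : int) T : is_tensor T0 (@l2_shift R c) T ->
  nice gamma XX (op_kernel c T0) -> hat_nice T.
Proof.
move=> TT nT0; split; first by case: TT.
exists (op_kernel c T0) => // y z i l; rewrite (tensor_coef _ _ _ _ TT) op_kernel_val.
have -> : (l - c == i) = (l - i == c) by apply/eqP/eqP; lia.
by case: ifP; rewrite ?mulr1 ?mulr0.
Qed.

Definition hat_basis_at (x : X) (i : int) : Hhat :=
  oapp (fun x' : XX => l2_basis R (x', i)) 0 (insub x).

Lemma hat_basis_at_val (x : XX) i : hat_basis_at (val x) i = l2_basis R (x, i).
Proof. by rewrite /hat_basis_at valK. Qed.

Lemma hat_basis_atE (x : X) i (z : XX) l : XX x ->
  hat_basis_at x i (z, l) = ((val z == x) && (l == i))%:R.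
Proof.
move=> /XX_lift[x' <-].
by rewrite hat_basis_at_val l2_basisE xpair_eqE (inj_eq val_inj).
Qed.

(** Bounded degree leaves finitely many words, and no coefficient is counted twice: words of
    different lengths end on different levels, and words of one length have distinct values at a
    point of [XX]. Another operator can then be applied termwise. *)
Lemma nice_column t M D F (T : Hhat -> Hhat) k x i (y : XX) : nice_with gamma XX t M D F ->
  (forall (y z : XX) i l, T (l2_basis R (y, i)) (z, l) = t (l - i) (val z) (val y)) ->
  XX x -> deep gamma M k x -> val y = cw k x ->
  T (l2_basis R (y, i)) = \sum_(j <- words_near N (size k) D)
     F j k x *: hat_basis_at (cw j x) ((size j)%:Z - (size k)%:Z + i).
Proof.
move=> [_ h2 h3 h4 _] Tt XXx dk yk; apply: l2_ext => -[z l].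
rewrite Tt l2_sumE.
have termE j : (F j k x *: hat_basis_at (cw j x) ((size j)%:Z - (size k)%:Z + i)) (z, l) =
    if (val z == cw j x) && (l - i == (size j)%:Z - (size k)%:Z)
    then t (l - i) (val z) (val y) else 0.
  rewrite l2_scaleE hat_basis_atE; last exact: comp_word_in.
  have -> : (l == (size j)%:Z - (size k)%:Z + i) = (l - i == (size j)%:Z - (size k)%:Z).
    by apply/eqP/eqP; lia.
  by case: andP => [[/eqP -> /eqP ->]|_]; rewrite ?mulr0// mulr1 yk h3.
have [t0|/eqP tn] := eqVneq (t (l - i) (val z) (val y)) 0.
  by rewrite t0 big1// => j _; rewrite termE t0; case: ifP.
have dD := h2 _ _ _ (valXX z) (valXX y) tn.
have := tn; rewrite {1}yk => /(h4 _ _ _ _ XXx (valXX z) dk)[j jk zj].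
have jin : j \in words_near N (size k) D by rewrite mem_words_near; lia.
rewrite (bigD1_seq j)//=; last exact: uniq_words_near.
have eqj : l - i == (size j)%:Z - (size k)%:Z by apply/eqP; lia.
have /eqP zj' := zj; rewrite termE zj' eqj/= big1 ?addr0// => j' jj'.
rewrite termE; case: andP => // -[/eqP zj'' /eqP lj'].
have sjj' : size j' = size j by lia.
have := comp_word_inj sigmaK XX_inv XX_disj XXx sjj'.
by rewrite -zj zj'' => /(_ erefl) ejj'; rewrite ejj' eqxx in jj'.
Qed.

Lemma hat_nice_comp T T' : hat_nice T -> hat_nice T' -> hat_nice (T \o T').
Proof.
move=> [bT [tT [MT [DT [FT nT]]] TE]] [bT' [tS [MS [DS [FS nS]]] T'E]].
split; first exact: bounded_op_comp.
(* The kernel is read off from source level 0; [formula] shows that all source levels give the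
   same. *)
pose t (d : int) (z y : X) : R[i] := oapp (fun z' : XX =>
  oapp (fun y' : XX => T (T' (l2_basis R (y', 0))) (z', d)) 0 (insub y)) 0 (insub z).
have tval (d : int) (z y : XX) : t d (val z) (val y) = T (T' (l2_basis R (y, 0))) (z, d).
  by rewrite /t !valK.
have formula k x (y z : XX) i l : XX x -> deep gamma MS k x -> val y = cw k x ->
    T (T' (l2_basis R (y, i))) (z, l) = \sum_(j <- words_near N (size k) DS)
      FS j k x * tT (l - i - ((size j)%:Z - (size k)%:Z)) (val z) (cw j x).
  move=> XXx dk yk; rewrite (nice_column i nS T'E XXx dk yk) bounded_op_sum// l2_sumE.
  apply: eq_bigr => j _; rewrite l2_scaleE; congr (_ * _).
  have [w wj] := XX_lift (comp_word_in XX_inv j XXx).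
  by rewrite -wj hat_basis_at_val TE; congr (tT _ _ _); lia.
exists t => [|y z i l].
  apply: (nice_mul XX_inv nT nS) => k x z d XXx XXz dk.
  have [y yk] := XX_lift (comp_word_in XX_inv k XXx); have [z' <-] := XX_lift XXz.
  by rewrite -yk tval (formula k x)// subr0.
have [k [x [XXx yk dk]]] := deep_exists XX_inv MS (valXX y).
by rewrite tval /= (formula k x)// (formula k x)// subr0.
Qed.

Lemma nice0 : nice gamma XX (fun _ _ _ => 0 : R[i]).
Proof.
exists 0, 0, (fun _ _ _ => 0); split => //.
by move=> j k; exact: continuous_cplx_cst.
Qed.

Lemma hat_nice_star : star_subalgebra hat_nice.
Proof.
split.
- by move=> T [].
- split.
    split; first exact: bounded_op0.
    by exists (fun _ _ _ => 0) => //; exact: nice0.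
  move=> c T T' [bT [t nt TE]] [bT' [t' nt' T'E]].
  split; first exact: bounded_op_comb.
  exists (fun d z y => c * t d z y + t' d z y) => [|y z i l]; first exact: nice_lin.
  by rewrite -TE -T'E.
- exact: hat_nice_comp.
- move=> T T' [bT [t nt TE]] bT' TT'; split=> //.
  exists (fun d z y => (t (- d) y z)^*) => [|y z i l]; first exact: nice_adjoint.
  by rewrite (adjoint_coef _ _ TT') TE opprB.
Qed.

Lemma nice_rhoE (f : X * X -> R[i]^o) T0 :
  {within ifs_graph gamma, continuous f} -> is_rhoE gamma f T0 ->
  nice gamma XX (op_kernel 1 T0).
Proof.
move=> cf [bT0 T0E].
have T0E' (y z : X) : XX y -> XX z -> l2_at (T0 (ebat y)) z =
    \sum_(c < N) f (gamma c y, y) * (z == gamma c y)%:R.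
  move=> /XX_lift[y' <-] XXz; rewrite l2_basis_at_val T0E l2_at_sum//.
  apply: eq_bigr => c _; rewrite l2_at_basis//.
  by apply: (comp_word_in XX_inv [:: c]); exact: valXX.
(* A point of the graph is a pair of chains of lengths 1 and 0, so rho_E is rho_(1,0). *)
apply: (nice_symbol (m := 1) (n := 0) gamma_cont sigmaK XX_inv XX_disj
  (G := fun j k x => f (cw j x, cw k x))).
- move=> [|c []]// [|//] _ _; apply: (pull_within_continuous cf) => [x|x].
    apply: (@cvg_pair _ _ _ _ (nbhs (gamma c x)) (nbhs x)); last exact: cvg_id.
    exact: gamma_cont.
  by exists c.
- by move=> j j' k k' x _ _ _ _ -> ->.
- move=> [|c []]// [|//] x XXx _ _ /=; rewrite /op_kernel eqxx T0E'//; last first.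
    exact: (comp_word_in XX_inv [:: c]).
  rewrite (bigD1 c)//= eqxx mulr1 big1 ?addr0// => c' cc'.
  case: eqP => [e|_]; last by rewrite mulr0.
  have := @comp_word_inj _ _ _ _ _ sigmaK XX_inv XX_disj [:: c] [:: c'] x XXx erefl e.
  by move=> [ecc']; rewrite ecc' eqxx in cc'.
- move=> d z y XXz XXy; rewrite /op_kernel; case: eqP => // -> /=.
  rewrite T0E'// => s0; split=> //.
  have [c zc] : exists c, z = gamma c y.
    apply: contrapT => H; apply: s0; rewrite big1// => c _.
    by case: eqP => [zc|_]; rewrite ?mulr0//; case: H; exists c.
  by exists [:: c], [::], y.
Qed.

Lemma iter_ifs_image n (A : set X) y : iter n (ifs_image gamma) A y <->
  exists k x, [/\ size k = n, A x & y = cw k x].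
Proof.
elim: n y => [|n ih] y.
  by split=> [Ay|[k [x [/size0nil -> Ax ->]]]//]; exists [::], y.
rewrite iterS; split=> [[c _ [y' /ih[k [x [kn Ax ->]]] <-]]|].
  by exists (c :: k), x; rewrite /= kn.
move=> [k [x [kn Ax ->]]]; case: k kn => // c k [kn]; exists c => //; exists (cw k x) => //.
by apply/ih; exists k, x.
Qed.

Lemma nice_rho_range (m n : nat) T : rho_range R gamma XX m n T ->
  nice gamma XX (op_kernel (m%:Z - n%:Z) T).
Proof.
move=> [f cf [bT TE T0]].
pose chain (p : nat) (j : word) (x : X) : 'rV[X]_p.+1 := \row_(i < p.+1) cw (drop (p - i) j) x.
have T0E (k : n.-tuple 'I_N) (x z : X) : XX x -> XX z -> l2_at (T (ebat (cw k x))) z =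
    \sum_(j : m.-tuple 'I_N) f (chain m j x, chain n k x) * (z == cw j x)%:R.
  move=> /XX_lift[x' <-] XXz; have := TE k x'; rewrite /comp_word => ->.
  rewrite l2_at_sum//; apply: eq_bigr => j _; rewrite l2_at_basis//.
  by apply: (comp_word_in XX_inv); exact: valXX.
have chain_cont p j : continuous (chain p j).
  by apply: row_continuous => i; exact: comp_word_cont.
have chainP p (j : word) x : size j = p -> is_chain gamma (chain p j x).
  move=> jp i; have ip : (p - i.+1 < size j)%N by rewrite jp; have := ltn_ord i; lia.
  have i0 : 'I_N by case: j jp ip => [|c j _ _]; [|exact: c].
  exists (nth i0 j (p - i.+1)); rewrite !mxE /=.
  have -> : (p - bump 0 i = p - i.+1)%N by [].
  rewrite (drop_nth i0 ip)/=; congr (gamma _ (foldr gamma x (drop _ j))).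
  by have := ltn_ord i; lia.
have chain0 p (j : word) x : size j = p -> chain p j x ord0 ord0 = x.
  by move=> jp; rewrite mxE subn0 -jp drop_size.
apply: (nice_symbol (m := m) (n := n) gamma_cont sigmaK XX_inv XX_disj
  (G := fun j k x => f (chain m j x, chain n k x))).
- move=> j k jm kn; apply: (pull_within_continuous cf) => [x|x].
    by apply: (@cvg_pair _ _ _ _ (nbhs (chain m j x)) (nbhs (chain n k x)));
      exact: chain_cont.
  by split=> /=; rewrite ?chain0//; exact: chainP.
(* The letters applied after stage i can be stripped from both words, so over one base point a chain
   is determined by its end point. *)
- have chain_eq p (j j' : word) x : size j = p -> size j' = p -> cw j x = cw j' x ->
      chain p j x = chain p j' x.
    move=> jp jp' e; apply/rowP => i; rewrite !mxE.
    apply: (comp_word_sizeI sigmaK (j := take (p - i) j) (k := take (p - i) j')).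
      by rewrite !size_take jp jp'.
    by rewrite -!comp_word_cat !cat_take_drop.
  by move=> j j' k k' x jm jm' kn kn' /(chain_eq _ _ _ _ jm jm') -> /(chain_eq _ _ _ _ kn kn') ->.
- move=> j k x XXx /eqP jm /eqP kn; rewrite /op_kernel eqxx.
  rewrite (T0E (Tuple kn))//; last exact: comp_word_in.
  rewrite (bigD1 (Tuple jm))//= eqxx mulr1 big1 ?addr0// => j' jj'.
  case: eqP => [e|_]; last by rewrite mulr0.
  case/eqP: jj'; apply: val_inj; apply/esym.
  by apply: (comp_word_inj sigmaK XX_inv XX_disj XXx _ e); rewrite size_tuple (eqP jm).
- move=> d z y XXz XXy; rewrite /op_kernel; case: eqP => // -> Tn; split=> //.
  have [|nit] := pselect (iter n (ifs_image gamma) XX y); last first.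
    exfalso; apply: Tn; have [y' yy'] := XX_lift XXy.
    rewrite -yy' l2_basis_at_val T0 ?yy'//.
    by have [z' <-] := XX_lift XXz; rewrite l2_at_val.
  move=> /iter_ifs_image[k [x [/eqP kn XXx yk]]].
  move: Tn; rewrite yk (T0E (Tuple kn))// => s0.
  have [j zj] : exists j : m.-tuple 'I_N, z = cw j x.
    apply: contrapT => Hn; apply: s0; rewrite big1// => j _.
    by case: eqP => [zj|_]; rewrite ?mulr0//; case: Hn; exists j.
  by exists j, k, x; rewrite size_tuple (eqP kn).
Qed.

Lemma nice_op_kernel_lin c (a : R[i]) T T' : nice gamma XX (op_kernel c T) ->
  nice gamma XX (op_kernel c T') -> nice gamma XX (op_kernel c (a *: T + T')).
Proof.
move=> nT nT'; rewrite (_ : op_kernel _ _ =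
  fun d z y => a * op_kernel c T d z y + op_kernel c T' d z y).
  exact: nice_lin.
apply/funext => d; apply/funext => z; apply/funext => y; rewrite /op_kernel.
case: eqP => _; last by rewrite mulr0 addr0.
by rewrite /l2_at; case: insubP => [z' _ _ //|_] /=; rewrite mulr0 addr0.
Qed.

Lemma Bk_approx (c : int) T (e : R) : Bk R gamma XX c T -> 0 < e ->
  exists2 T', nice gamma XX (op_kernel c T') &
    forall p q, normc (T (l2_basis R q) p - T' (l2_basis R q) p) <= e.
Proof.
move=> BT e0; have [T' sT' TT'] := op_closure_coef BT e0; exists T' => //.
have : smallest (@op_subspace R XX) [set T | exists m n : nat,
     m%:Z - n%:Z = c /\ rho_range R gamma XX m n T] `<=`
   [set T | nice gamma XX (op_kernel c T)].
  apply: smallest_sub; last by move=> S [m [n [<-]]]; exact: nice_rho_range.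
  split; last by move=> a S S'; exact: nice_op_kernel_lin.
  rewrite /= (_ : op_kernel _ _ = fun _ _ _ => 0); first exact: nice0.
  apply/funext => d; apply/funext => z; apply/funext => y; rewrite /op_kernel.
  by case: eqP => // _; rewrite /l2_at; case: insubP.
exact.
Qed.

(** Chains of length 0 are points, so rho_A is rho_(0,0). This serves both the inclusion into [hatD]
    and the niceness of the generators. *)
Lemma rhoA_rho_range (a : X -> R[i]^o) T : continuous a -> is_rhoA a T ->
  rho_range R gamma XX 0 0 T.
Proof.
move=> ca [bT TE]; exists (fun p : 'rV[X]_1 * 'rV[X]_1 => a (p.1 ord0 ord0)).
  apply: continuous_subspaceT => p B /= /ca nB.
  have : nbhs p.1 [set q : 'rV[X]_1 | B (a (q ord0 ord0))].
    exists (fun=> (fun=> a @^-1` B)) => [i s|q]; last exact.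
    by rewrite !ord1.
  by move=> h; apply: (@cvg_fst _ _ (nbhs p.1) (nbhs p.2) _ _ h).
split=> // [k x|y []//]; last exact: valXX.
rewrite (bigD1 [tuple])//= big1 => [|j]; last by rewrite (tuple0 j) => /eqP.
by rewrite addr0 (tuple0 k) /comp_chain/= !mxE /comp_word/= l2_basis_at_val TE.
Qed.

Lemma rho_range_Bk (m n : nat) T : rho_range R gamma XX m n T ->
  Bk R gamma XX (m%:Z - n%:Z) T.
Proof.
move=> rT; have [f _ [bT _ _]] := rT; split=> // e e0.
exists T => [|u]; last by rewrite subrr normr0 mulr_ge0// ltW.
by apply: sub_gen_smallest; exists m, n.
Qed.

End nice_operators.

(** * Equality of the two algebras and maximality *)

Lemma op_closure_subset (R : realType) (S : choiceType) (B B' : set (l2 R S -> l2 R S)) :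
  B `<=` B' -> op_closure B `<=` op_closure B'.
Proof.
move=> BB' T [bT BT]; split=> // e /BT[T' BT' TT'].
by exists T' => //; exact: BB'.
Qed.

Lemma ifs_image_setT (X : topologicalType) (N : nat) (gamma : 'I_N -> X -> X) :
  iter 1 (ifs_image gamma) [set: X] = [set x | in_image gamma x].
Proof.
apply/seteqP; split=> [_ [c _ [x _ <-]]|_ [c [x ->]]]; first by exists c, x.
by exists c => //; exists x.
Qed.

Lemma continuous_separation (R : realType) (X : topologicalType) (x y : X) :
  compact [set: X] -> hausdorff_space X -> x <> y ->
  exists2 a : X -> R[i]^o, continuous a & a x <> a y.
Proof.
move=> cptX hausX xy; have cl (z : X) : closed [set z].
  exact: (accessible_closed_set1 (hausdorff_accessible hausX)).
have xy0 : [set x] `&` [set y] = set0.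
  apply/seteqP; split=> // z [/= zx zy]; apply: xy.
  by rewrite -zx -zy.
have [f [cf fx fy _]] := urysohn_ext_itv (compact_normal hausX cptX)
  (cl x) (cl y) xy0 (@ltr01 R).
exists (fun z => ((f z)%:C)%C : R[i]^o).
  apply/continuous_Re_Im; split; first exact: cf.
  by move=> z; exact: cvg_cst.
have -> : f x = 0 by apply: fx; exists x.
have -> : f y = 1 by apply: fy; exists y.
by move=> /complexI/esym/eqP; rewrite oner_eq0.
Qed.

Theorem theorem1p2p7 (R : realType) (X : topologicalType) (N : nat)
    (gamma : 'I_N -> X -> X) (XX U : set X) (sigma : X -> X)
    (cptX : compact [set: X]) (hausX : hausdorff_space X)
    (gamma_cont : forall k, continuous (gamma k))
    (XX_dense : dense XX) (XX_inv : completely_invariant gamma XX)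
    (XX_disj : trivIset [set: 'I_N] (fun k => gamma k @` XX))
    (XX_inj : forall k, set_inj XX (gamma k))
    (gamma_emb : forall k, topological_embedding (gamma k))
    (U_dense : dense U) (U_open : open U)
    (U_disj : trivIset [set: 'I_N] (fun k => gamma k @` U))
    (U_img : forall k, open (gamma k @` U) /\ gamma k @` U `<=` U)
    (XX_U : XX `<=` U)
    (XX_comeager : comeager XX)
    (gamma_free : essentially_free gamma)
    (gamma_clopen : forall n, clopen (iter n (ifs_image gamma) [set: X]))
    (sigma_cont : {within ifs_image gamma [set: X], continuous sigma})
    (sigmaK : forall k x, sigma (gamma k x) = x) :
  hat_rhoA_range R XX = hatD R gamma XX
  /\ masa (hat_rhoA_range R XX) (cstar_hat_rho R gamma XX).
Proof.
have [img_open img_closed] := gamma_clopen 1%N.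
rewrite ifs_image_setT in img_open img_closed.
have limit t0 := @nice_diagonal_limit R X N gamma sigma XX gamma_cont sigmaK XX_inv
  XX_dense cptX hausX img_open img_closed gamma_free t0.
have rhoA_star := @hat_rhoA_star R X XX cptX.
have rhoA_closed := @hat_rhoA_closed R X XX cptX XX_dense.
have [[rhoA_bounded rhoA_sub _ _] _] := rhoA_star.
have D_gen k T0 T : Dk R gamma XX k T0 -> is_tensor T0 (@l2_shift R k) T ->
    hat_rhoA_range R XX T.
  move=> [BT0 [_ T0diag]] TT; have [bT _] := TT.
  have [|e e0|a ca aE] := limit (op_kernel k T0).
  - move=> d _ _ /XX_lift[z <-] /XX_lift[y <-] zy; rewrite op_kernel_val.
    by case: ifP => // _; rewrite -inner_basisl T0diag// => zy'; rewrite zy' in zy.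
  - have [T' nT' TT'] := Bk_approx gamma_cont sigmaK XX_inv XX_disj BT0 e0.
    exists (op_kernel k T') => // d _ _ /XX_lift[z <-] /XX_lift[y <-].
    rewrite !op_kernel_val; case: ifP => // _.
    by rewrite subrr Normc.normc0 ltW.
  (* For k <> 0 the diagonal of [T0] vanishes, so T is zero and its symbol is the zero function. *)
  pose b x : R[i]^o := if k == 0 then a x else 0.
  have cb : continuous b.
    by rewrite /b; case: (k == 0); [exact: ca|exact: continuous_cplx_cst].
  apply/(hat_rhoA_rangeP cptX); split=> //; exists b => //.
  apply: hat_mul_basis => // -[z l] [y i]; rewrite (tensor_coef _ _ _ _ TT).
  have -> : T0 (l2_basis R y) z = op_kernel k T0 k (val z) (val y).
    by rewrite op_kernel_val eqxx.
  rewrite xpair_eqE; have [->/=|zy] := eqVneq z y.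
    rewrite aE; last exact: valXX.
    rewrite /b; case: eqP => [->|_]; last by rewrite mul0r; case: ifP.
    by rewrite subr0; case: eqP => _; rewrite ?mulr1 ?mulr0.
  rewrite op_kernel_val eqxx -inner_basisl T0diag ?mul0r//.
  exact/eqP.
split.
  apply/seteqP; split=> [T TA|].
    have [a [T0 [ca rT0 TT]]] := TA; have [bT0 T0E] := rT0.
    apply: subset_op_closure => //; last first.
      apply: sub_gen_smallest; exists 0, T0; split=> //; split.
        exact: (rho_range_Bk (rhoA_rho_range gamma ca rT0)).
      split=> // x y xy; rewrite inner_basisl T0E l2_scaleE l2_basisE.
      by case: eqP => // _; rewrite mulr0.
    apply: smallest_sub.
      split; first exact: bounded_op0.
      by move=> c T1 T2; exact: bounded_op_comb.
    by move=> S [k [S0 [_ []]]].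
  apply: subset_trans rhoA_closed; apply: op_closure_subset.
  by apply: smallest_sub => // T [k [T0 [DT0 TT]]]; exact: D_gen DT0 TT.
split=> //.
  by move=> T TA; apply: sub_gen_smallest; left.
move=> D' [[D'b D's D'm D'a] D'comm] AD' D'C; apply/seteqP; split=> // T D'T.
(* Limits of nice operators form a C*-algebra containing both kinds of generators, hence the whole
   generated algebra. *)
have cstar_nice : cstar_hat_rho R gamma XX `<=`
    op_closure (hat_nice (R := R) gamma (XX := XX)).
  apply: smallest_sub.
    by apply: op_closure_cstar; exact: (hat_nice_star R sigmaK XX_inv XX_disj).
  apply: subset_trans (subset_op_closure _); last by move=> S [].
  move=> S [[a [S0 [ca rS0 SS]]]|[f [S0 [cf rS0 SS]]]].
    apply: (hat_nice_tensor SS).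
    exact: (nice_rho_range gamma_cont sigmaK XX_inv XX_disj (rhoA_rho_range gamma ca rS0)).
  apply: (hat_nice_tensor SS).
  exact: (nice_rhoE gamma_cont sigmaK XX_inv XX_disj cf rS0).
have [bT nT] := cstar_nice _ (D'C _ D'T).
(* Commuting with multiplication by [a] gives a(z) T_zy = a(y) T_zy. This removes only the entries
   between different points of [XX]; those between different levels over one point are left to
   essential freeness, through [limit]. *)
have Tdiag (y z : XX) i l : z <> y -> T (l2_basis R (y, i)) (z, l) = 0.
  move=> zy; have [|a ca azy] := @continuous_separation R X (val z) (val y) cptX hausX.
    by move=> /val_inj.
  have [Ma bMa MaE] := hat_mul_exists XX cptX ca.
  have D'Ma : D' Ma.
    by apply: AD'; apply/(hat_rhoA_rangeP cptX); split=> //; exists a.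
  have : Ma (T (l2_basis R (y, i))) (z, l) = T (Ma (l2_basis R (y, i))) (z, l).
    by rewrite -[LHS]/((Ma \o T) _ _) D'comm.
  rewrite MaE /=.
  have -> : Ma (l2_basis R (y, i)) = a (val y) *: l2_basis R (y, i).
    apply: l2_ext => p; rewrite (hat_mul_coef _ _ MaE) l2_scaleE l2_basisE.
    by case: eqP; rewrite ?mulr1 ?mulr0.
  rewrite bounded_opZ// l2_scaleE => /eqP; rewrite -subr_eq0 -mulrBl mulf_eq0.
  by case/orP => /eqP; [move/eqP; rewrite subr_eq0 => /eqP|].
pose t (d : int) (z y : X) : R[i] := oapp (fun z' : XX =>
  oapp (fun y' : XX => T (l2_basis R (y', 0)) (z', d)) 0 (insub y)) 0 (insub z).
have tval (d : int) (z y : XX) : t d (val z) (val y) = T (l2_basis R (y, 0)) (z, d).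
  by rewrite /t !valK.
have approx e : 0 < e -> exists2 t', nice gamma XX t' & forall (y z : XX) i l,
    normc (T (l2_basis R (y, i)) (z, l) - t' (l - i) (val z) (val y)) <= e.
  move=> /(op_closure_coef (conj bT nT))[T' [_ [t' nt' T'E]] TT'].
  by exists t' => // y z i l; rewrite -T'E.
have [|e /approx[t' nt' tt']|a ca tE] := limit t.
- move=> d _ _ /XX_lift[z <-] /XX_lift[y <-] zy; rewrite tval Tdiag// => zy'.
  by rewrite zy' in zy.
- exists t' => // d _ _ /XX_lift[z <-] /XX_lift[y <-].
  by rewrite tval; have := tt' y z 0 d; rewrite subr0.
apply/(hat_rhoA_rangeP cptX); split=> //; exists a => //.
apply: hat_mul_basis => // -[z l] [y i]; rewrite xpair_eqE.
have [->/=|/eqP zy] := eqVneq z y; last by rewrite Tdiag.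
(* Dependence on [l - i] alone passes to the limit: both entries are within e / 2 of the same
   coefficient of an approximant. *)
transitivity (t (l - i) (val y) (val y)).
  apply/eqP; rewrite -subr_eq0; apply/eqP; apply: normc_eq0_le => e e0.
  have [t' _ tt'] := approx _ (divr_gt0 e0 (ltr0Sn _ 1)).
  have := tt' y y i l; have := tt' y y 0 (l - i); rewrite subr0 -tval.
  move: (t _ _ _) (t' _ _ _) (T _ _) => r s r' rs r's.
  have -> : r' - r = (r' - s) - (r - s) by ring.
  by rewrite (splitr e); apply: le_trans (ler_normcD _ _) _; rewrite normc_opp lerD.
by rewrite tE ?subr_eq0//; exact: valXX.
Qed.
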